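(* The polynomials that are both key polynomials and Young key polynomials are exactly the Schur polynomials.
   Context: Fix $n$ and consider weak compositions of length $n$. The key polynomial (Demazure character) is $\kappa_a=\pi_{w_a}x^{\mathrm{sort}(a)}$, where $\pi_i f=\partial_i(x_if)$, $\partial_i f=(f-s_if)/(x_i-x_{i+1})$, $\mathrm{sort}(a)$ is the weakly decreasing rearrangement of $a$, and $w_a$ the minimal length permutation sending $a$ to $\mathrm{sort}(a)$. The Young key polynomial is $\hat\kappa_a(x_1,\ldots,x_n)=\kappa_{\mathrm{rev}(a)}(x_n,\ldots,x_1)$, where $\mathrm{rev}(a)$ is $a$ reversed. Schur polynomials means $s_\lambda(x_1,\ldots,x_n)$. *)

(* Defs.v *)
From mathcomp Require Import all_boot all_order all_fingroup all_algebra.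
From mathcomp Require Export mpoly.
From mathcomp Require Import zify.

Set Implicit Arguments.
Unset Strict Implicit.
Unset Printing Implicit Defensive.

Import GRing.Theory.
Local Open Scope ring_scope.

Section Permutations.
Variable n : nat.
Implicit Types (w : 'S_n) (i : 'I_n.-1) (s : seq 'I_n.-1).

(* [i : 'I_n.-1] indexes the adjacent pair of positions [i], [i.+1]
   (counted from 0). *)
Definition lo i : 'I_n := widen_ord (leq_pred n) i.

Lemma hi_subproof i : (i.+1 < n)%N.
Proof. by case: i => i /=; case: n. Qed.

Definition hi i : 'I_n := Ordinal (hi_subproof i).

Definition simple i : 'S_n := tperm (lo i) (hi i).

Definition perm_length w : nat :=
  #|[set p : 'I_n * 'I_n | (p.1 < p.2)%N && (w p.2 < w p.1)%N]|.

(* In MathComp [(w * v)%g x = v (w x)]; this is therefore the functional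
   composite s_{i_1} o ... o s_{i_r} for s = [:: i_1; ...; i_r]. *)
Definition word_perm s : 'S_n := foldr (fun i w => (w * simple i)%g) 1%g s.

Definition reduced_word w s : bool :=
  (word_perm s == w) && (size s == perm_length w).

Lemma word_perm_rcons s i : word_perm (rcons s i) = (simple i * word_perm s)%g.
Proof. by elim: s => [|j s IH] /=; rewrite ?mul1g ?mulg1 // IH mulgA. Qed.

Lemma perm_length_descent w i : (w (hi i) < w (lo i))%N ->
  perm_length w = (perm_length (simple i * w)%g).+1.
Proof.
move=> dsc; rewrite /perm_length (cardsD1 (lo i, hi i)).
rewrite inE /= leqnn dsc add1n; congr _.+1.
pose g (p : 'I_n * 'I_n) := (simple i p.1, simple i p.2).
have gK : involutive g by case=> a b; rewrite /g /= /simple !tpermK.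
rewrite -(card_imset _ (inv_inj gK)); congr #|pred_of_set _|.
apply/setP=> p; rewrite -{1}(gK p) (mem_imset _ _ (inv_inj gK)) !inE /=.
rewrite /g /= !permM; case: (boolP (w (simple i p.2) < w (simple i p.1))%N);
  rewrite ?andbF //= !andbT.
rewrite xpair_eqE /simple; case: p => a b /=.
case: (tpermP (lo i) (hi i) a) => [->|->|/eqP + /eqP +];
case: (tpermP (lo i) (hi i) b) => [->|->|/eqP + /eqP +];
  rewrite -?(inj_eq val_inj) /=; lia.
Qed.

Lemma no_descent w : (forall i, w (lo i) <= w (hi i))%N -> w = 1%g.
Proof.
move=> asc.
have wlt : forall k (a b : 'I_n), (b = a + k.+1 :> nat)%N -> (w a < w b)%N.
  elim=> [|k IH] a b ab.
    have an : (a < n.-1)%N by have := ltn_ord b; lia.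
    have := asc (Ordinal an).
    have -> : lo (Ordinal an) = a by apply: val_inj.
    have -> : hi (Ordinal an) = b by apply: val_inj => /=; lia.
    rewrite leq_eqVlt => /orP[/eqP /val_inj /perm_inj e|//].
    by move: ab; rewrite e; lia.
  have cn : (a + k.+1 < n)%N by have := ltn_ord b; lia.
  have h1 := IH a (Ordinal cn) erefl.
  apply: ltn_trans h1 _.
  have an : (a + k.+1 < n.-1)%N by have := ltn_ord b; lia.
  have := asc (Ordinal an).
  have -> : lo (Ordinal an) = Ordinal cn by apply: val_inj.
  have -> : hi (Ordinal an) = b by apply: val_inj => /=; lia.
  rewrite leq_eqVlt => /orP[/eqP /val_inj /perm_inj e|//].
  by move: ab; rewrite -e /=; lia.
have wge : forall k (a : 'I_n), a = k :> nat -> (k <= w a)%N.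
  elim=> [//|k IH] a ak.
  have kn : (k < n)%N by have := ltn_ord a; lia.
  have := wlt 0%N (Ordinal kn) a; have := IH (Ordinal kn) erefl.
  by rewrite /= ak; lia.
have wle : forall k (a : 'I_n), (n = a + k.+1)%N -> (w a <= a)%N.
  elim=> [|k IH] a ak; first by have := ltn_ord (w a); lia.
  have an : (a.+1 < n)%N by lia.
  have := wlt 0%N a (Ordinal an); have := IH (Ordinal an).
  by move=> /=; lia.
apply/permP=> a; rewrite perm1; apply/val_inj/eqP; rewrite eqn_leq.
rewrite (wge a a erefl) (wle (n - a.+1)%N) //.
by have := ltn_ord a; lia.
Qed.

Lemma reduced_word_exists w : exists s, reduced_word w s.
Proof.
elim: {w}(perm_length w) {-2}w (erefl (perm_length w)) => [|k IH] w wk.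
  exists [::]; rewrite /reduced_word wk /= andbT eq_sym; apply/eqP/no_descent.
  by move=> i; rewrite leqNgt; apply/negP => /perm_length_descent; rewrite wk.
case: (pickP (fun i => (w (hi i) < w (lo i))%N)) => [i dsc | asc].
  have [s /andP[/eqP sw /eqP ss]] : exists s, reduced_word (simple i * w)%g s.
    by apply: IH; have := perm_length_descent dsc; rewrite wk; case.
  exists (rcons s i); rewrite /reduced_word word_perm_rcons size_rcons sw ss.
  by rewrite mulgA tperm2 mul1g eqxx (perm_length_descent dsc) /=.
have w1 : w = 1%g by apply: no_descent => i; rewrite leqNgt asc.
suff: perm_length w = 0%N by rewrite wk.
rewrite w1 /perm_length.
rewrite (_ : [set _ | _] = set0) ?cards0 //.
by apply/setP=> p; rewrite !inE !perm1; lia.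
Qed.

Definition some_reduced_word w : seq 'I_n.-1 := xchoose (reduced_word_exists w).

Lemma some_reduced_wordP w : reduced_word w (some_reduced_word w).
Proof. exact: xchooseP. Qed.

End Permutations.

Section DemazureOperators.
Variable n : nat.
Implicit Types (i : 'I_n.-1) (f g : {mpoly int[n]}).

Lemma divdiff_exists i f :
  exists g, ('X_(lo i) - 'X_(hi i)) * g == f - msym (simple i) f.
Proof.
move: f; apply: mpolyind => [|c m p _ _ [g /eqP eg]].
  by exists 0; rewrite mulr0 msym0 subr0.
suff [h eh] : exists h : {mpoly int[n]}, ('X_(lo i) - 'X_(hi i)) * h
                        = 'X_[m] - msym (simple i) 'X_[m].
  exists (c *: h + g); apply/eqP.
  by rewrite mulrDr -scalerAr eh eg msymD msymZ scalerBr opprD addrACA.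
pose P f := exists h, ('X_(lo i) - 'X_(hi i)) * h = f - msym (simple i) f.
have PM f1 f2 : P f1 -> P f2 -> P (f1 * f2).
  case=> [h1 e1] [h2 e2]; exists (h1 * f2 + msym (simple i) f1 * h2).
  rewrite mulrDr mulrA e1 mulrCA e2 msymM mulrBl mulrBr addrA.
  by rewrite subrK.
have P1 : P 1 by exists 0; rewrite mulr0 msym1 subrr.
rewrite -/(P _) mpolyXE_id; apply: (big_ind P) => // j _.
elim: (m j) => [|k IH]; first by rewrite expr0.
rewrite exprS; apply: PM IH; rewrite /P msymX.
have -> : [multinom U_(j)%MM ((simple i)^-1%g k') | k' < n]
          = U_(simple i j)%MM.
  by apply/mnmP=> k'; rewrite !mnmE -(inj_eq (@perm_inj _ (simple i))) permKV.
rewrite /simple; case: tpermP => [->|->|_ _].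
- by exists 1; rewrite mulr1.
- by exists (-1); rewrite mulrN1 opprB.
by exists 0; rewrite mulr0 subrr.
Qed.

Definition divdiff i f : {mpoly int[n]} := xchoose (divdiff_exists i f).

Lemma divdiffP i f :
  ('X_(lo i) - 'X_(hi i)) * divdiff i f = f - msym (simple i) f.
Proof. by apply/eqP/(xchooseP (divdiff_exists i f)). Qed.

(* {mpoly int[n]} has no division, so that the quotient defining the divided
   difference is obtained by choice; it is unique. *)
Lemma divdiff_unique i f g :
  ('X_(lo i) - 'X_(hi i)) * g = f - msym (simple i) f -> g = divdiff i f.
Proof.
rewrite -divdiffP; apply: mulfI; rewrite subr_eq0; apply/eqP=> /mpolyP e.
move: (e U_(lo i)%MM); rewrite !mcoeffX eqxx.
have -> : (U_(hi i)%MM == U_(lo i)%MM :> 'X_{1..n}) = false.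
  apply/eqP=> h; have := congr1 (fun m : 'X_{1..n} => m (hi i)) h.
  by rewrite !mnmE eqxx -(inj_eq val_inj) /=; lia.
by move=> /eqP; rewrite oner_eq0.
Qed.

Definition demazure i f : {mpoly int[n]} := divdiff i ('X_(lo i) * f).

(* pi_w = pi_{i_1} ... pi_{i_r} for a reduced word w = s_{i_1} ... s_{i_r};
   by the braid relations the choice of the reduced word is immaterial. *)
Definition demazure_perm (w : 'S_n) f : {mpoly int[n]} :=
  foldr demazure f (some_reduced_word w).

End DemazureOperators.

Section KeyPolynomials.
Variable n : nat.
Implicit Types (a : n.-tuple nat) (w : 'S_n).

Definition sort_comp a : n.-tuple nat := [tuple of sort geq a].

(* Permutations act on compositions by permuting positions on the right,
   (a . w)_i = a_{w(i)}, so that a . (s_{i_1} ... s_{i_r}) = sort(a) means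
   a = sort(a) . (s_{i_r} ... s_{i_1}).  With this convention
   kappa_a = pi_i kappa_{a . s_i} whenever a_i < a_{i+1}. *)
Definition sorts a w : bool :=
  [forall i, tnth (sort_comp a) i == tnth a (w i)].

Definition min_sorts a w : bool :=
  sorts a w && [forall v, sorts a v ==> (perm_length w <= perm_length v)%N].

Lemma min_sorts_exists a : exists w, min_sorts a w.
Proof.
have [w0 sw0] : exists w, sorts a w.
  have /tuple_permP[w ew] : perm_eq (sort_comp a) a by rewrite perm_sort.
  exists w; apply/forallP=> i; apply/eqP.
  by rewrite (tnth_nth 0%N) ew -tnth_nth tnth_mktuple.
case: (arg_minnP (@perm_length n) sw0) => w sw wmin.
by exists w; apply/andP; split=> //; apply/'forall_implyP.
Qed.

(* The minimum is attained exactly once. *)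
Definition min_sort_perm a : 'S_n := xchoose (min_sorts_exists a).

Lemma min_sort_permP a : min_sorts a (min_sort_perm a).
Proof. exact: xchooseP. Qed.

Definition key a : {mpoly int[n]} :=
  demazure_perm (min_sort_perm a) 'X_[Multinom (sort_comp a)].

Definition rev_vars (f : {mpoly int[n]}) : {mpoly int[n]} :=
  msym (perm (@rev_ord_inj n)) f.

Definition young_key a : {mpoly int[n]} := rev_vars (key [tuple of rev a]).

End KeyPolynomials.

Section SchurPolynomials.
Variable n : nat.

(* Partitions with at most n parts, padded with zeros. *)
Definition is_partition (la : n.-tuple nat) : bool := sorted geq la.

(* The box in row [tag b] and column [tagged b] of the Young diagram. *)
Definition box (la : n.-tuple nat) := {i : 'I_n & 'I_(tnth la i)}.

Definition is_ssyt (la : n.-tuple nat) (T : {ffun box la -> 'I_n}) : bool :=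
  [forall b : box la, forall c : box la,
     ((tag b == tag c) && (tagged b <= tagged c)%N ==> (T b <= T c)%N)
  && ((tag b < tag c)%N && (tagged b == tagged c :> nat) ==> (T b < T c)%N)].

Definition schur (la : n.-tuple nat) : {mpoly int[n]} :=
  \sum_(T : {ffun box la -> 'I_n} | is_ssyt T) \prod_(b : box la) 'X_(T b).

End SchurPolynomials.

(* Main.v *)
Require Import Defs.
From mathcomp Require Import all_boot all_order all_fingroup all_algebra.
From mathcomp Require Import zify ring.

(* Every exponent of [kappa_a] that permutes [a] lies above [a] in Bruhat order,
   whereas a Young key polynomial of shape [la] always contains the smallest
   such exponent, rev(la), as its coefficient at x^rev(la) is the leading
   coefficient of the reversed key.  So a polynomial of both kinds is
   [kappa_rev(la)].  Conversely [kappa_rev(la)] is symmetric, and the operators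
   [pi_i] do not change the alternating sum of [x^rho f]; hence
   a_rho kappa_rev(la) = a_(la + rho), which is a_rho s_la by the bialternant
   formula. *)

Set Implicit Arguments.
Unset Strict Implicit.
Unset Printing Implicit Defensive.

Import GRing.Theory.
Local Open Scope ring_scope.

(** * Demazure operators and the braid relations *)

(** [key] rests on two choices, a minimal sorting permutation and a reduced word of it. The relation
    [is_key] forgets both: it admits every chain of ascents that ends at a dominant exponent, and
    the braid relations make the result unique. Properties of keys can then be proved along a chain,
    one operator at a time. Two statistics follow the exponents through one operator: [excess],
    which cannot grow under [pi_i] and whose equality at all thresholds means rearrangement, and
    [prefix_count], which compares rearrangements. Symmetry is delicate where two neighbouring
    entries are equal, since no chain then starts with the corresponding [pi_i]. As Schur
    polynomials are given by tableaux, the bialternant formula has to be proved as well: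
    determinants and tableau sums obey the same recursion on the number of variables. *)

Section DivisionIdentities.
Variable R : idomainType.
Implicit Types x y z u v f g h p : R.

Lemma division_add x y f f1 g g1 p q :
  (x - y) * p = x * f - y * f1 -> (x - y) * q = x * g - y * g1 ->
  (x - y) * (p + q) = x * (f + g) - y * (f1 + g1).
Proof. by move=> ep eq; rewrite mulrDr ep eq; ring. Qed.

Lemma division_mul x y f f1 g p :
  (x - y) * p = x * f - y * f1 -> (x - y) * (g * p) = x * (g * f) - y * (g * f1).
Proof. by move=> ep; rewrite mulrCA ep; ring. Qed.

Lemma far_division x y u v f f1 f2 f12 g g1 h h2 p q :
  x - y != 0 -> u - v != 0 ->
  (u - v) * g = u * f - v * f2 -> (u - v) * g1 = u * f1 - v * f12 ->
  (x - y) * p = x * g - y * g1 ->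
  (x - y) * h = x * f - y * f1 -> (x - y) * h2 = x * f2 - y * f12 ->
  (u - v) * q = u * h - v * h2 -> p = q.
Proof.
move=> xy uv eg eg1 ep eh eh2 eq; apply: (mulfI uv); apply: (mulfI xy).
transitivity ((u - v) * ((x - y) * p)); first by ring.
rewrite ep; transitivity (x * ((u - v) * g) - y * ((u - v) * g1)); first by ring.
rewrite eg eg1 eq; symmetry.
transitivity (u * ((x - y) * h) - v * ((x - y) * h2)); first by ring.
by rewrite eh eh2; ring.
Qed.

(** The hypotheses are the defining equations of [pi_1] and [pi_2] and their images under
    reflections; a suffix such as [12] stands for [s_1 s_2]. Clearing all three denominators leaves
    an alternating expression in the six translates of [f]. The next lemma reaches the same
    expression from the other side of the braid relation. *)
Lemma braid_division_l x y z f f1 f2 f12 f21 f121 g g2 g12 h h1 p :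
  (x - y) * g = x * f - y * f1 -> (x - z) * g2 = x * f2 - z * f21 ->
  (y - z) * g12 = y * f12 - z * f121 ->
  (y - z) * h = y * g - z * g2 -> (x - z) * h1 = x * g - z * g12 ->
  (x - y) * p = x * h - y * h1 ->
  (x - y) * (x - z) * (y - z) * p =
  x * y * (x * f - y * f1) - x * z * (x * f2 - z * f21) + y * z * (y * f12 - z * f121).
Proof.
move=> eg eg2 eg12 eh eh1 ep; rewrite -eg2 -eg12.
transitivity ((x - z) * (y - z) * ((x - y) * p)); first by ring.
rewrite ep; transitivity (x * (x - z) * ((y - z) * h) - y * (y - z) * ((x - z) * h1)).
  by ring.
rewrite eh eh1; transitivity (x * y * ((x - y) * g)
  - x * z * ((x - z) * g2) + y * z * ((y - z) * g12)); first by ring.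
by rewrite eg.
Qed.

Lemma braid_division_r x y z f f1 f2 f12 f21 f121 g g1 g21 h h2 p :
  (y - z) * g = y * f - z * f2 -> (x - z) * g1 = x * f1 - z * f12 ->
  (x - y) * g21 = x * f21 - y * f121 ->
  (x - y) * h = x * g - y * g1 -> (x - z) * h2 = x * g - z * g21 ->
  (y - z) * p = y * h - z * h2 ->
  (x - y) * (x - z) * (y - z) * p =
  x * y * (x * f - y * f1) - x * z * (x * f2 - z * f21) + y * z * (y * f12 - z * f121).
Proof.
move=> eg eg1 eg21 eh eh2 ep.
transitivity ((x - z) * (x - y) * ((y - z) * p)); first by ring.
rewrite ep; transitivity (y * (x - z) * ((x - y) * h) - z * (x - y) * ((x - z) * h2)).
  by ring.
rewrite eh eh2; transitivity (x ^+ 2 * ((y - z) * g)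
  - y ^+ 2 * ((x - z) * g1) + z ^+ 2 * ((x - y) * g21)); first by ring.
by rewrite eg eg1 eg21; ring.
Qed.

End DivisionIdentities.

Section DemazureOperators.
Variable n : nat.
Implicit Types (i j : 'I_n.-1) (f g : {mpoly int[n]}) (m : 'X_{1..n}).

Lemma msymU (s : 'S_n) (k : 'I_n) : msym s ('X_k : {mpoly int[n]}) = 'X_(s k).
Proof.
rewrite msymX; congr 'X_[_]; apply/mnmP=> l.
by rewrite !mnmE -(inj_eq (@perm_inj _ s)) permKV.
Qed.

Lemma mpolyXB_neq0 (a b : 'I_n) : a != b -> 'X_a - 'X_b != 0 :> {mpoly int[n]}.
Proof.
move=> ab; rewrite subr_eq0; apply/eqP=> /mpolyP /(_ U_(a)%MM).
rewrite !mcoeffX eqxx; case: eqP => // e; have := congr1 (fun m : 'X_{1..n} => m a) e.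
by rewrite !mnmE eqxx eq_sym (negPf ab).
Qed.

Lemma lo_neq_hi i : lo i != hi i.
Proof. by rewrite -(inj_eq val_inj) /=; lia. Qed.

Lemma simple_lo i : simple i (lo i) = hi i. Proof. exact: tpermL. Qed.

Lemma simple_hi i : simple i (hi i) = lo i. Proof. exact: tpermR. Qed.

Lemma simple_other i (k : 'I_n) : k != lo i -> k != hi i -> simple i k = k.
Proof. by move=> h1 h2; rewrite tpermD // eq_sym. Qed.

Lemma simpleK i : involutive (simple i). Proof. exact: tpermK. Qed.

Lemma msym_simpleK i : involutive (@msym n int (simple i)).
Proof. by move=> f; rewrite -msymMm tperm2 msym1m. Qed.

Lemma demazureP i f : ('X_(lo i) - 'X_(hi i)) * demazure i f
  = 'X_(lo i) * f - 'X_(hi i) * msym (simple i) f.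
Proof. by rewrite divdiffP msymM msymU simple_lo. Qed.

Lemma demazure_unique i f g : ('X_(lo i) - 'X_(hi i)) * g
  = 'X_(lo i) * f - 'X_(hi i) * msym (simple i) f -> demazure i f = g.
Proof.
by rewrite -demazureP; move/(mulfI (mpolyXB_neq0 (lo_neq_hi i))).
Qed.

(** Applying [s_i] to the defining equation negates both sides, so the reflected quotient satisfies
    the same equation. *)
Lemma msym_demazure i f : msym (simple i) (demazure i f) = demazure i f.
Proof.
apply/esym/demazure_unique; apply: oppr_inj.
rewrite -mulNr !opprB -{1}simple_lo -{2}(simple_hi i) -!msymU -msymB -msymM demazureP.
by rewrite msymB !msymM !msymU simple_lo simple_hi msym_simpleK.
Qed.

Lemma demazureMl i f g :
  msym (simple i) g = g -> demazure i (g * f) = g * demazure i f.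
Proof.
move=> sg; by apply: demazure_unique; rewrite msymM sg; apply: division_mul (demazureP i f).
Qed.

Lemma demazure_fixed i g : msym (simple i) g = g -> demazure i g = g.
Proof. by move=> sg; apply: demazure_unique; rewrite sg mulrBl. Qed.

Lemma demazureD i f g : demazure i (f + g) = demazure i f + demazure i g.
Proof.
apply: demazure_unique; rewrite msymD.
exact: division_add (demazureP i f) (demazureP i g).
Qed.

Lemma demazureZ i (c : int) f : demazure i (c *: f) = c *: demazure i f.
Proof.
apply: demazure_unique; rewrite -scalerAr demazureP msymZ scalerBr.
by rewrite !scalerAr.
Qed.

Lemma simpleC i j : (i.+1 < j)%N -> (simple i * simple j = simple j * simple i)%g.
Proof.
move=> ij; rewrite conjgC; congr (_ * _)%g.
by rewrite tpermJ !simple_other // -val_eqE /=; lia.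
Qed.

Lemma msym_simpleC i j f : (i.+1 < j)%N ->
  msym (simple i) (msym (simple j) f) = msym (simple j) (msym (simple i) f).
Proof.
by move=> ij; rewrite -!msymMm (simpleC ij).
Qed.

Lemma demazureC_lt i j f : (i.+1 < j)%N ->
  demazure i (demazure j f) = demazure j (demazure i f).
Proof.
move=> ij.
have xy : 'X_(lo i) - 'X_(hi i) != 0 :> {mpoly int[n]} by apply/mpolyXB_neq0/lo_neq_hi.
have uv : 'X_(lo j) - 'X_(hi j) != 0 :> {mpoly int[n]} by apply/mpolyXB_neq0/lo_neq_hi.
apply: (far_division xy uv (demazureP j f) _ (demazureP i _) (demazureP i f) _ (demazureP j _)).
  have := congr1 (msym (simple i)) (demazureP j f).
  rewrite !(msymM, msymB) !msymU !simple_other; try by rewrite -val_eqE /=; lia.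
  exact.
have := congr1 (msym (simple j)) (demazureP i f).
rewrite !(msymM, msymB) -(msym_simpleC f ij) !msymU !simple_other; try by rewrite -val_eqE /=; lia.
exact.
Qed.

Lemma braid_simple i j : j = i.+1 :> nat ->
  (simple i * simple j * simple i = simple j * simple i * simple j)%g.
Proof.
move=> ij; have e : hi i = lo j by apply: val_inj.
have d1 : lo i != hi j by rewrite -val_eqE /=; lia.
have d2 : lo i != hi i by exact: lo_neq_hi.
have d3 : hi i != hi j by rewrite e; exact: lo_neq_hi.
(* Both sides are conjugates of a transposition, and both equal the transposition of [lo i] and
   [hi j]. *)
have conj (s t : 'S_n) : (s^-1 = s -> s * t * s = t ^ s)%g by rewrite conjgE mulgA => ->.
rewrite !conj ?tpermV // /simple -e !tpermJ tpermL tpermR !tpermD // 1?eq_sym //.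
Qed.

Lemma demazure_braid i j f : j = i.+1 :> nat ->
  demazure i (demazure j (demazure i f)) = demazure j (demazure i (demazure j f)).
Proof.
move=> ij; have e : hi i = lo j by apply: val_inj.
set x : {mpoly int[n]} := 'X_(lo i); set y : {mpoly int[n]} := 'X_(hi i).
set z : {mpoly int[n]} := 'X_(hi j).
have xy : x - y != 0 by apply/mpolyXB_neq0/lo_neq_hi.
have yz : y - z != 0 by rewrite /y e; apply/mpolyXB_neq0/lo_neq_hi.
have xz : x - z != 0 by apply/mpolyXB_neq0; rewrite -val_eqE /=; lia.
pose s1 := @msym n int (simple i); pose s2 := @msym n int (simple j).
have s1x : s1 x = y by rewrite /s1 msymU simple_lo.
have s1y : s1 y = x by rewrite /s1 msymU simple_hi.
have s1z : s1 z = z by rewrite /s1 msymU simple_other // -val_eqE /=; lia.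
have s2x : s2 x = x by rewrite /s2 msymU simple_other // -val_eqE /=; lia.
have s2y : s2 y = z by rewrite /s2 /y e msymU simple_lo.
have s2z : s2 z = y by rewrite /s2 /y e msymU simple_hi.
have br : s1 (s2 (s1 f)) = s2 (s1 (s2 f)).
  by rewrite /s1 /s2 -!msymMm !mulgA braid_simple.
have E1 h : (x - y) * demazure i h = x * h - y * s1 h by rewrite demazureP.
have E2 h : (y - z) * demazure j h = y * h - z * s2 h by rewrite /y e demazureP.
have P1 h : s1 (demazure i h) = demazure i h by apply: msym_demazure.
have P2 h : s2 (demazure j h) = demazure j h by apply: msym_demazure.
have S1E2 h : (x - z) * s1 (demazure j h) = x * s1 h - z * s1 (s2 h).
  by have := congr1 s1 (E2 h); rewrite /s1 !(msymM, msymB) -/s1 s1y s1z.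
have S2E1 h : (x - z) * s2 (demazure i h) = x * s2 h - z * s2 (s1 h).
  by have := congr1 s2 (E1 h); rewrite /s2 !(msymM, msymB) -/s2 s2y s2x.
have S1S2E1 h : (y - z) * s1 (s2 (demazure i h)) = y * s1 (s2 h) - z * s1 (s2 (s1 h)).
  by have := congr1 s1 (S2E1 h); rewrite /s1 !(msymM, msymB) -/s1 s1x s1z.
have S2S1E2 h : (x - y) * s2 (s1 (demazure j h)) = x * s2 (s1 h) - y * s2 (s1 (s2 h)).
  by have := congr1 s2 (S1E2 h); rewrite /s2 !(msymM, msymB) -/s2 s2x s2z.
apply: (mulfI (mulf_neq0 (mulf_neq0 xy xz) yz)).
(* The invariance of [demazure i f] under [s1] is used in the first term only, to match the form of
   the division identity. *)
have L1 := eq_ind _ (fun u => _ = x * u - _) (S1E2 (demazure i f)) _ (P1 f).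
have L2 := eq_ind _ (fun u => _ = x * u - _) (S2E1 (demazure j f)) _ (P2 f).
have S2S1 := S2S1E2 f; rewrite -br in S2S1.
have L := braid_division_l (E1 f) (S2E1 f) (S1S2E1 f) (E2 (demazure i f)) L1
  (E1 (demazure j (demazure i f))).
have R := braid_division_r (E2 f) (S1E2 f) S2S1 (E1 (demazure j f)) L2
  (E2 (demazure i (demazure j f))).
exact: etrans L (esym R).
Qed.

End DemazureOperators.

(** * Key polynomials along chains of ascents *)

Section KeyChains.
Variable n : nat.
Implicit Types (i j : 'I_n.-1) (k l : 'I_n) (p q r : {mpoly int[n]}) (a b m : 'X_{1..n}).

Definition swap i a : 'X_{1..n} := [multinom a (simple i k) | k < n].

Lemma swapE i a k : swap i a k = a (simple i k). Proof. exact: mnmE. Qed.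

Lemma swap_lo i a : swap i a (lo i) = a (hi i).
Proof. by rewrite swapE simple_lo. Qed.

Lemma swap_hi i a : swap i a (hi i) = a (lo i).
Proof. by rewrite swapE simple_hi. Qed.

Lemma swap_other i a k : k != lo i -> k != hi i -> swap i a k = a k.
Proof. by move=> h1 h2; rewrite swapE simple_other. Qed.

Lemma swapC i j a : (i.+1 < j)%N -> swap i (swap j a) = swap j (swap i a).
Proof.
by move=> ij; apply/mnmP=> k; rewrite !swapE -!permM (simpleC ij).
Qed.

Lemma swap_braid i j a : j = i.+1 :> nat ->
  swap i (swap j (swap i a)) = swap j (swap i (swap j a)).
Proof.
by move=> ij; apply/mnmP=> k; rewrite !swapE -!permM !mulgA braid_simple.
Qed.

Definition dominant a := forall i, (a (hi i) <= a (lo i))%N.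

Lemma dominant_le a k l : dominant a -> (k <= l)%N -> (a l <= a k)%N.
Proof.
move=> da; move e : (l - k)%N => d; elim: d l e => [|d IH] l e kl.
  by rewrite (_ : l = k) //; apply: val_inj => /=; lia.
have h1 : (l.-1 < n.-1)%N by have := ltn_ord l; lia.
have := da (Ordinal h1); have -> : hi (Ordinal h1) = l by apply: val_inj => /=; lia.
by move/leq_trans; apply; apply: IH => /=; lia.
Qed.

Lemma dominantVascent a : dominant a \/ exists i, (a (lo i) < a (hi i))%N.
Proof.
case: (pickP (fun i => (a (lo i) < a (hi i))%N)) => [i|h]; first by right; exists i.
by left=> i; rewrite leqNgt h.
Qed.

(** The length of the shortest permutation sorting [a], and hence the length of every chain from [a]
    to a dominant exponent. *)
Definition ascents a : nat :=
  #|[set p : 'I_n * 'I_n | (p.1 < p.2)%N && (a p.1 < a p.2)%N]|.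

Lemma ascents_swap i a : (a (lo i) < a (hi i))%N -> ascents a = (ascents (swap i a)).+1.
Proof.
move=> asc; rewrite /ascents (cardsD1 (lo i, hi i)).
rewrite inE /= leqnn asc add1n; congr _.+1.
pose g (p : 'I_n * 'I_n) := (simple i p.1, simple i p.2).
have gK : involutive g by case=> x y; rewrite /g /= !simpleK.
rewrite -(card_imset _ (inv_inj gK)); congr #|pred_of_set _|.
apply/setP=> p; rewrite -{1}(gK p) (mem_imset _ _ (inv_inj gK)) !inE /=.
rewrite /g /= !swapE; case: (boolP (a (simple i p.1) < a (simple i p.2))%N);
  rewrite ?andbF //= !andbT.
rewrite xpair_eqE /simple; case: p => x y /=.
case: (tpermP (lo i) (hi i) x) => [->|->|/eqP + /eqP +];
case: (tpermP (lo i) (hi i) y) => [->|->|/eqP + /eqP +];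
  rewrite -?(inj_eq val_inj) /=; lia.
Qed.

Lemma dominant_ascents a : dominant a -> ascents a = 0%N.
Proof.
move=> da; apply/eqP; rewrite cards_eq0; apply/eqP/setP=> -[k l]; rewrite !inE /=.
by apply/negP=> /andP[kl]; have := dominant_le da (ltnW kl); lia.
Qed.

(** A relation rather than a function, so that a chain may begin with whichever ascent suits the
    argument. *)
Inductive is_key : 'X_{1..n} -> {mpoly int[n]} -> Prop :=
| IsKeyDominant a : dominant a -> is_key a 'X_[a]
| IsKeyStep a i p : (a (lo i) < a (hi i))%N -> is_key (swap i a) p ->
    is_key a (demazure i p).

Lemma is_key_exists a : exists p, is_key a p.
Proof.
move: {2}(ascents a) (erefl (ascents a)) => d; elim: d a => [|d IH] a e;
  have [da|[i lt_i]] := dominantVascent a; try by exists 'X_[a]; constructor.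
  by move: (ascents_swap lt_i); rewrite e.
have [p kp] : exists p, is_key (swap i a) p.
  by apply: IH; move: (ascents_swap lt_i); rewrite e => -[].
by exists (demazure i p); constructor.
Qed.

Lemma is_key_inv a p : is_key a p -> dominant a /\ p = 'X_[a] \/
  exists i q, [/\ (a (lo i) < a (hi i))%N, is_key (swap i a) q & p = demazure i q].
Proof. by case=> [b db|b i q bi kq]; [left | right; exists i, q]. Qed.

Lemma hiE i j : j = i.+1 :> nat -> hi i = lo j.
Proof. by move=> ij; apply: val_inj. Qed.

(* The diamond below two ascents [i < j] closes by commutation or by the braid
   relation. *)
Lemma is_key_diamond a i j p q : (i < j)%N ->
  (forall b p q, (ascents b < ascents a)%N -> is_key b p -> is_key b q -> p = q) ->
  (a (lo i) < a (hi i))%N -> (a (lo j) < a (hi j))%N ->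
  is_key (swap i a) p -> is_key (swap j a) q -> demazure i p = demazure j q.
Proof.
move=> ij IH ai aj kp kq.
have si := ascents_swap ai; have sj := ascents_swap aj.
move: ij; rewrite leq_eqVlt => /orP[/eqP/esym ij|ij].
  have e := hiE ij.
  have n1 : lo i != lo j by rewrite -val_eqE /=; lia.
  have n2 : lo i != hi j by rewrite -val_eqE /=; lia.
  have n3 : hi j != lo i by rewrite eq_sym.
  have n4 : hi j != hi i by rewrite -val_eqE /=; lia.
  (* Two adjacent ascents give three strictly increasing consecutive entries, so every step on
     either side of the hexagon is an ascent. *)
  have h1 : (swap i a (lo j) < swap i a (hi j))%N.
    by rewrite -{1}e swap_hi swap_other //; rewrite e in ai; lia.
  have h2 : (swap j (swap i a) (lo i) < swap j (swap i a) (hi i))%N.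
    by rewrite swap_other // swap_lo e swap_lo swap_other // e.
  have h3 : (swap j a (lo i) < swap j a (hi i))%N.
    by rewrite e swap_lo swap_other //; rewrite e in ai; lia.
  have h4 : (swap i (swap j a) (lo j) < swap i (swap j a) (hi j))%N.
    by rewrite -{1}e swap_hi (swap_other _ n1 n2) (swap_other _ n3 n4) swap_hi -e.
  have [r kr] := is_key_exists (swap i (swap j (swap i a))).
  have kr2 : is_key (swap j (swap i (swap j a))) r by rewrite -(swap_braid a ij).
  rewrite (IH _ _ _ _ kp (IsKeyStep h1 (IsKeyStep h2 kr))); last by rewrite si.
  rewrite (IH _ _ _ _ kq (IsKeyStep h3 (IsKeyStep h4 kr2))); last by rewrite sj.
  exact: demazure_braid.
have n1 : lo i != lo j by rewrite -val_eqE /=; lia.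
have n2 : lo i != hi j by rewrite -val_eqE /=; lia.
have n3 : hi i != lo j by rewrite -val_eqE /=; lia.
have n4 : hi i != hi j by rewrite -val_eqE /=; lia.
have h1 : (swap i a (lo j) < swap i a (hi j))%N by rewrite !swap_other // eq_sym.
have h2 : (swap j a (lo i) < swap j a (hi i))%N by rewrite !swap_other.
have [r kr] := is_key_exists (swap i (swap j a)).
have kr2 : is_key (swap j (swap i a)) r by rewrite -(swapC a ij).
rewrite (IH _ _ _ _ kp (IsKeyStep h1 kr2)); last by rewrite si.
rewrite (IH _ _ _ _ kq (IsKeyStep h2 kr)); last by rewrite sj.
exact: demazureC_lt.
Qed.

(** Newman's argument: local confluence from the diamond, and strong induction on [ascents]. *)
Lemma is_key_unique a p q : is_key a p -> is_key a q -> p = q.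
Proof.
move: {2}(ascents a).+1 (ltnSn (ascents a)) => d.
elim: d a p q => [//|d IHd] a p q lt_ad.
have IH b p' q' : (ascents b < ascents a)%N -> is_key b p' -> is_key b q' -> p' = q'.
  by move=> ba; apply: IHd; lia.
move=> /is_key_inv[[da ->]|[i [p' [ai kp ->]]]] /is_key_inv[[da' ->]|[j [q' [aj kq ->]]]].
- by [].
- by have := da j; lia.
- by have := da' i; lia.
have [ij|ij|/val_inj ij] := ltngtP i j.
- exact: is_key_diamond IH _ _ kp kq.
- exact/esym/(is_key_diamond _ IH _ _ kq kp).
rewrite -ij in kq *; congr demazure; apply: IH kp kq.
by rewrite (ascents_swap ai).
Qed.

Lemma demazureC i j p : (i.+1 < j)%N || (j.+1 < i)%N ->
  demazure i (demazure j p) = demazure j (demazure i p).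
Proof. by case/orP=> ij; [apply: demazureC_lt | apply/esym/demazureC_lt]. Qed.

(** At a strict ascent [p] is an image of [pi_i]. At an equality take another ascent [j]. If [j] is
    far from [i], then [pi_i] fixes the shorter key and commutes with [pi_j]. If it is adjacent,
    then [p = pi_j pi_i r], where the exponent of [r] has equal entries at [j]; hence [r = pi_j r],
    and the braid relation rewrites [p] as an image of [pi_i]. *)
Lemma is_key_sym a p i :
  (a (lo i) <= a (hi i))%N -> is_key a p -> msym (simple i) p = p.
Proof.
move: {2}(ascents a).+1 (ltnSn (ascents a)) => d.
elim: d a p i => [//|d IHd] a p i lt_ad.
rewrite leq_eqVlt => /orP[/eqP ai|ai] kp; last first.
  have [q kq] := is_key_exists (swap i a).
  by rewrite (is_key_unique kp (IsKeyStep ai kq)) msym_demazure.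
case: (is_key_inv kp) => [[da ->]|[j [q [aj kq ->]]]].
  rewrite msymX; congr 'X_[_]; apply/mnmP=> k; rewrite mnmE tpermV.
  by case: tpermP => [->|->|].
have IH b p' i' : (ascents b < ascents a)%N -> (b (lo i') <= b (hi i'))%N ->
    is_key b p' -> demazure i' p' = p'.
  by move=> ba bi kb; apply: demazure_fixed; apply: IHd bi kb; lia.
have sj := ascents_swap aj.
have ij : i <> j by move=> e; move: aj; rewrite -e ai ltnn.
have [far|] := boolP ((i.+1 < j)%N || (j.+1 < i)%N).
  have fq : demazure i q = q.
    apply: (IH (swap j a)) kq; first by rewrite sj.
    by rewrite !swap_other ?ai // -val_eqE /=; lia.
  by rewrite -fq -demazureC // msym_demazure.
have nij : nat_of_ord i != nat_of_ord j by apply/eqP=> /val_inj.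
rewrite negb_or -!leqNgt => adj.
have [e|e] : (j = i.+1 :> nat \/ i = j.+1 :> nat)%N by lia.
  have eh := hiE e.
  have n1 : lo i != lo j by rewrite -val_eqE /=; lia.
  have n2 : lo i != hi j by rewrite -val_eqE /=; lia.
  have n3 : hi j != lo i by rewrite eq_sym.
  have n4 : hi j != hi i by rewrite -val_eqE /=; lia.
  have h1 : (swap j a (lo i) < swap j a (hi i))%N.
    by rewrite swap_other // eh swap_lo ai eh.
  have [r kr] := is_key_exists (swap i (swap j a)).
  rewrite (is_key_unique kq (IsKeyStep h1 kr)).
  have fr : demazure j r = r.
    apply: IH kr; first by rewrite sj (ascents_swap h1).
    by rewrite -eh swap_hi (swap_other _ n1 n2) (swap_other _ n3 n4) swap_hi ai eh.
  by rewrite -fr -demazure_braid // msym_demazure.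
have eh := hiE e.
have n1 : hi i != lo j by rewrite -val_eqE /=; lia.
have n2 : hi i != hi j by rewrite -val_eqE /=; lia.
have n3 : lo j != lo i by rewrite -val_eqE /=; lia.
have n4 : lo j != hi i by rewrite -val_eqE /=; lia.
have h1 : (swap j a (lo i) < swap j a (hi i))%N.
  by rewrite -eh swap_hi swap_other // -ai -eh.
have [r kr] := is_key_exists (swap i (swap j a)).
rewrite (is_key_unique kq (IsKeyStep h1 kr)).
have fr : demazure j r = r.
  apply: IH kr; first by rewrite sj (ascents_swap h1).
  by rewrite eh swap_lo (swap_other _ n3 n4) (swap_other _ n1 n2) swap_lo eh ai.
by rewrite -fr demazure_braid // msym_demazure.
Qed.

(** A new letter raises or lowers the length by exactly one. *)
Lemma perm_length_word s : (perm_length (word_perm s : 'S_n) <= size s)%N.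
Proof.
elim/last_ind: s => [|s i IH].
  rewrite /perm_length leqn0 cards_eq0; apply/eqP/setP=> p; rewrite !inE /= !perm1.
  by lia.
rewrite word_perm_rcons size_rcons; set w := word_perm s in IH *.
have [asc|desc] := ltnP (w (lo i)) (w (hi i)).
  have := @perm_length_descent n (simple i * w)%g i.
  by rewrite !permM simple_lo simple_hi mulgA tperm2 mul1g => /(_ asc) ->.
have := @perm_length_descent n w i; case: ltnP => [_ /(_ isT) h|h _]; first by lia.
have /val_inj/perm_inj/eqP : w (lo i) = w (hi i) :> nat by apply/eqP; rewrite eqn_leq h.
by rewrite (negPf (lo_neq_hi i)).
Qed.

Lemma mnm_word_cons a i s : [multinom a (word_perm (i :: s) k) | k < n]
  = [multinom swap i a (word_perm s k) | k < n].
Proof. by apply/mnmP=> k; rewrite !mnmE permM. Qed.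

Lemma sorting_word a :
  exists s, size s = ascents a /\ dominant [multinom a (word_perm s k) | k < n].
Proof.
move: {2}(ascents a) (erefl (ascents a)) => d; elim: d a => [|d IH] a e;
  have [da|[i lt_i]] := dominantVascent a.
- by exists [::]; split=> // j; rewrite !mnmE !perm1.
- by move: (ascents_swap lt_i); rewrite e.
- by move: e; rewrite dominant_ascents.
have [s [ss ds]] : exists s, size s = ascents (swap i a) /\
    dominant [multinom swap i a (word_perm s k) | k < n].
  by apply: IH; move: (ascents_swap lt_i); rewrite e => -[].
by exists (i :: s); rewrite mnm_word_cons (ascents_swap lt_i) /= ss.
Qed.

(** A letter lowers [ascents] by at most one, and by one only at an ascent. A sorting word of size
    [ascents a] therefore uses ascents only, which makes it a chain for [is_key]. *)
Lemma sorting_word_key a s b : b = [multinom a (word_perm s k) | k < n] ->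
  dominant b -> (ascents a <= size s)%N /\
  ((size s <= ascents a)%N -> is_key a (foldr (@demazure n) 'X_[b] s)).
Proof.
elim: s a => [|i s IH] a.
  have -> : [multinom a (word_perm [::] k) | k < n] = a.
    by apply/mnmP=> k; rewrite mnmE perm1.
  by move=> -> da; rewrite (dominant_ascents da); split=> [|_]; last exact: IsKeyDominant.
rewrite mnm_word_cons => eb db; have [le1 kb] := IH _ eb db.
have [ai|ai|ai] := ltngtP (a (lo i)) (a (hi i)).
- have e := ascents_swap ai; split=> /= [|le2]; first by lia.
  by constructor=> //; apply: kb; lia.
- have e : ascents (swap i a) = (ascents (swap i (swap i a))).+1.
    by apply: ascents_swap; rewrite swap_lo swap_hi.
  have ek : swap i (swap i a) = a by apply/mnmP=> k; rewrite !swapE simpleK.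
  by rewrite ek in e; split=> /=; lia.
have e : swap i a = a.
  by apply/mnmP=> k; rewrite swapE /simple; case: tpermP => [->|->|].
by rewrite e in le1; split=> /=; lia.
Qed.

Lemma sorted_dominant (t : n.-tuple nat) : sorted geq t -> dominant (Multinom t).
Proof.
move=> st i; rewrite !mnm_tnth !(tnth_nth 0%N) /=.
have geq_trans : transitive geq by move=> x y z /= h1 h2; apply: leq_trans h2 h1.
have geq_refl : reflexive geq by move=> x; exact: leqnn.
apply: (sorted_leq_nth geq_trans geq_refl 0%N st); rewrite ?inE ?size_tuple //=.
  exact: (ltn_ord (lo i)).
exact: (ltn_ord (hi i)).
Qed.

Lemma dominant_sorted a : dominant a -> sorted geq (a : n.-tuple nat).
Proof.
move=> da; apply/(sortedP 0%N)=> k; rewrite size_tuple => kn.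
have k1 : (k < n.-1)%N by lia.
by have := da (Ordinal k1); rewrite !(mnm_nth 0%N).
Qed.

Lemma sort_comp_sorted (t : n.-tuple nat) : sorted geq (sort_comp t).
Proof. by apply: sort_sorted => x y /=; exact: leq_total. Qed.

Lemma dominant_sorts (t : n.-tuple nat) (w : 'S_n) :
  dominant [multinom (Multinom t) (w k) | k < n] -> sorts t w.
Proof.
move=> dw; apply/forallP=> k; apply/eqP.
have e : val (sort_comp t) = val (mktuple (fun k => tnth t (w k))).
  apply: (@sorted_eq _ geq).
  - by move=> x y z /= h1 h2; apply: leq_trans h2 h1.
  - by move=> x y /andP[h1 h2]; apply/eqP; rewrite eqn_leq; apply/andP.
  - exact: sort_comp_sorted.
  - suff <- : multinom_val [multinom (Multinom t) (w k) | k < n]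
        = mktuple (fun k => tnth t (w k)) by exact: dominant_sorted dw.
    by apply: eq_from_tnth => l; rewrite !tnth_mktuple.
  by rewrite perm_sort perm_sym; apply/(@tuple_permP _ n _ t); exists w.
by rewrite (tnth_nth 0%N) e -tnth_nth tnth_mktuple.
Qed.

(** Minimality of the chosen permutation, compared with the word that sorts ascent by ascent, bounds
    the size of its reduced word by [ascents]. *)
Lemma key_is_key (t : n.-tuple nat) : is_key (Multinom t) (key t).
Proof.
rewrite /key /demazure_perm; set w := min_sort_perm t.
have /andP[/forallP sw /'forall_implyP wmin] := min_sort_permP t.
have /andP[/eqP ew /eqP es] := some_reduced_wordP w.
set s := some_reduced_word w in ew es *.
have [] // := @sorting_word_key (Multinom t) s (Multinom (sort_comp t)).
- by apply/mnmP=> k; rewrite mnmE ew !mnm_tnth; apply/eqP.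
- exact/sorted_dominant/sort_comp_sorted.
move=> _; apply; have [s0 [ss0 ds0]] := sorting_word (Multinom t).
rewrite es -ss0; apply: leq_trans (perm_length_word s0).
exact/wmin/dominant_sorts.
Qed.

End KeyChains.

(** * Exponents of key polynomials *)

Section Supports.
Variable n : nat.
Implicit Types (i j : 'I_n.-1) (k l : 'I_n) (p q r : {mpoly int[n]}) (a b m u : 'X_{1..n}).

(** The lattice points of the segment from [m] to [swap i m], the only exponents that [pi_i x^m] can
    involve. *)
Definition in_string i m m' :=
  [/\ forall k, k != lo i -> k != hi i -> m' k = m k,
      (m' (lo i) + m' (hi i) = m (lo i) + m (hi i))%N &
      (minn (m (lo i)) (m (hi i)) <= m' (lo i) <= maxn (m (lo i)) (m (hi i)))%N].

Lemma demazureXlo i d :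
  demazure i ('X_(lo i) ^+ d) = \sum_(e < d.+1) 'X_(lo i) ^+ (d - e) * 'X_(hi i) ^+ e.
Proof.
apply: demazure_unique; rewrite -subrXX !exprS; congr (_ - _ * _).
by elim: d => [|d IH]; rewrite ?msym1 // !exprS msymM -IH msymU simple_lo.
Qed.

(** Up to sign, the complete homogeneous sum of degree [d.+1] in two variables without its two pure
    powers; for [d = 0] nothing remains. *)
Lemma demazureXhi i d :
  demazure i ('X_(hi i) ^+ d.+1) =
  - (('X_(lo i) * 'X_(hi i)) * \sum_(e < d) 'X_(lo i) ^+ (d.-1 - e) * 'X_(hi i) ^+ e).
Proof.
apply: demazure_unique; rewrite mulrN mulrCA -subrXX.
have -> : msym (simple i) ('X_(hi i) ^+ d.+1) = 'X_(lo i) ^+ d.+1 :> {mpoly int[n]}.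
  by elim: d => [|d IH]; rewrite ?expr1 ?msymU ?simple_hi // exprS msymM IH msymU simple_hi.
by rewrite !exprS; ring.
Qed.

Lemma msupp_sumX_exists (N : nat) (F : 'I_N -> 'X_{1..n}) m :
  m \in msupp (\sum_(e < N) 'X_[F e] : {mpoly int[n]}) -> exists e, m = F e.
Proof.
move/msupp_sum_le; case/flatten_mapP => e _; rewrite msuppX inE => /eqP->; by exists e.
Qed.

Lemma msupp_demazureX i m m' : m' \in msupp (demazure i 'X_[m]) -> in_string i m m'.
Proof.
(* The largest [s_i]-invariant monomial dividing [x^m]; it passes through [pi_i] and leaves a pure
   power of one variable. *)
pose u := [multinom (if (k == lo i) || (k == hi i) then minn (m (lo i)) (m (hi i))
                     else m k) | k < n].
have symu : msym (simple i) 'X_[u] = 'X_[u] :> {mpoly int[n]}.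
  rewrite msymX; congr 'X_[_]; apply/mnmP=> k; rewrite !mnmE tpermV /simple.
  by case: tpermP => [->|->|]; rewrite ?eqxx ?orbT.
have nlh := negPf (lo_neq_hi i); have nhl : (hi i == lo i) = false by rewrite eq_sym.
have [le_lh|lt_lh] := leqP (m (hi i)) (m (lo i)).
  have -> : m = (u + U_(lo i) *+ (m (lo i) - m (hi i)))%MM.
    apply/mnmP=> k; rewrite mnmDE mulmnE mnm1E mnmE.
    case: (eqVneq k (lo i)) => [->|n1]; first by rewrite ?eqxx ?nlh ?nhl /=; lia.
    case: (eqVneq k (hi i)) => [->|n2]; first by rewrite ?eqxx ?nlh ?nhl /=; lia.
    by rewrite ?[lo i == k]eq_sym ?(negPf n1) /=; lia.
  rewrite mpolyXD -mpolyXn (demazureMl _ symu) demazureXlo mulr_sumr.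
  under eq_bigr => e _ do rewrite !mpolyXn -!mpolyXD.
  case/msupp_sumX_exists => -[e le_e] -> /=.
  split=> [k n1 n2||]; rewrite !mnmDE !mulmnE !mnm1E !mnmE ?eqxx ?orbT ?nlh ?nhl //=.
  - by rewrite ![_ == k]eq_sym (negPf n1) (negPf n2) /=; lia.
  - by lia.
  - by lia.
have [d ed] : exists d, (m (hi i) = m (lo i) + d.+1)%N.
  by exists (m (hi i) - m (lo i)).-1; lia.
have -> : m = (u + U_(hi i) *+ d.+1)%MM.
  apply/mnmP=> k; rewrite mnmDE mulmnE mnm1E mnmE.
  case: (eqVneq k (lo i)) => [->|n1]; first by rewrite ?eqxx ?nlh ?nhl /=; lia.
  case: (eqVneq k (hi i)) => [->|n2]; first by rewrite ?eqxx ?nlh ?nhl /=; lia.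
  by rewrite ?[hi i == k]eq_sym ?(negPf n2) /=; lia.
rewrite mpolyXD -mpolyXn (demazureMl _ symu) demazureXhi mulrN mulrA mulr_sumr.
rewrite (perm_mem (msuppN _)).
under eq_bigr => e _ do rewrite !mpolyXn -!mpolyXD.
case/msupp_sumX_exists => -[e le_e] -> /=.
split=> [k n1 n2||]; rewrite !mnmDE !mulmnE !mnm1E !mnmE ?eqxx ?orbT ?nlh ?nhl //=.
- by rewrite ![_ == k]eq_sym (negPf n1) (negPf n2) /=; lia.
- by lia.
- by lia.
Qed.

Lemma demazure0 i : demazure i 0 = 0 :> {mpoly int[n]}.
Proof. by apply: demazure_unique; rewrite msym0 !mulr0 subr0. Qed.

Lemma msupp_demazure i p m' : m' \in msupp (demazure i p) ->
  exists2 m, m \in msupp p & in_string i m m'.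
Proof.
rewrite {1}[p]mpolyE (big_morph _ (@demazureD n i) (demazure0 i)).
move/msupp_sum_le; case/flatten_mapP => m; rewrite mem_filter /= => pm.
by rewrite demazureZ => /msuppZ_le /msupp_demazureX; exists m.
Qed.

(** The subtraction is truncated. Differences in [t] count the entries above [t], so agreement for
    all [t] means that two exponents are rearrangements of each other; convexity makes the value
    drop inside a string. *)
Definition excess a t : nat := (\sum_k (a k - t))%N.

Lemma sum_lo_hi i (F : 'I_n -> nat) : (\sum_k F k =
  F (lo i) + F (hi i) + \sum_(k | (k != lo i) && (k != hi i)) F k)%N.
Proof.
rewrite (bigD1 (lo i)) //= (bigD1 (hi i)) ?addnA //=.
by rewrite eq_sym lo_neq_hi.
Qed.

Lemma excess_perm a (w : 'S_n) t : excess [multinom a (w k) | k < n] t = excess a t.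
Proof.
rewrite /excess [RHS](reindex_inj (@perm_inj _ w)) /=.
by apply: eq_bigr => k _; rewrite mnmE.
Qed.

Lemma excess_swap i a t : excess (swap i a) t = excess a t.
Proof. exact: excess_perm. Qed.

Lemma excess_string i m m' t : in_string i m m' -> (excess m' t <= excess m t)%N.
Proof.
case=> h1 h2 h3; rewrite /excess !(sum_lo_hi i) leq_add //; first by lia.
by rewrite leq_eqVlt; apply/orP; left; apply/eqP/eq_bigr => k /andP[n1 n2]; rewrite h1.
Qed.

Lemma excess_string_eq i m m' : in_string i m m' -> excess m' =1 excess m ->
  m' = m \/ m' = swap i m.
Proof.
move=> [h1 h2 h3] e.
have e2 t : (m' (lo i) - t + (m' (hi i) - t) = m (lo i) - t + (m (hi i) - t))%N.
  have := e t; rewrite /excess !(sum_lo_hi i).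
  rewrite (eq_bigr (fun k => m k - t)%N); first by move=> /addIn.
  by move=> k /andP[n1 n2]; rewrite h1.
have [e3|e3] : m' (lo i) = m (lo i) \/ m' (lo i) = m (hi i).
(* Just below the larger end value, an interior point of the string has no excess left. *)
- by have := e2 (maxn (m (lo i)) (m (hi i))).-1; lia.
- left; apply/mnmP=> k.
  case: (eqVneq k (lo i)) => [->//|n1]; case: (eqVneq k (hi i)) => [->|n2]; first by lia.
  exact: h1.
right; apply/mnmP=> k.
case: (eqVneq k (lo i)) => [->|n1]; first by rewrite swap_lo.
case: (eqVneq k (hi i)) => [->|n2]; first by rewrite swap_hi; lia.
by rewrite swap_other // h1.
Qed.

Lemma is_key_excess a p m t : is_key a p -> m \in msupp p -> (excess m t <= excess a t)%N.
Proof.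
move=> kp; elim: kp m => [b _|b i q _ _ IH] m.
  by rewrite msuppX inE => /eqP->.
case/msupp_demazure => m0 /IH le0 st; apply: leq_trans (excess_string t st) _.
by rewrite -(excess_swap i b).
Qed.

(** Among rearrangements of one exponent, the pointwise comparison of these numbers for all [K] and
    [t] is the tableau criterion for Bruhat order. *)
Definition prefix_count a (K t : nat) : nat := (\sum_(k < n | (k < K)%N) (t < a k))%N.

Lemma prefix_countS a k t :
  prefix_count a k.+1 t = (prefix_count a k t + (t < a k))%N.
Proof.
rewrite /prefix_count (bigD1 k) //= addnC; congr (_ + _)%N; apply: eq_bigl => l.
by rewrite -val_eqE /=; lia.
Qed.

Lemma prefix_count_split a K t : prefix_count a n t =
  (prefix_count a K t + \sum_(k < n | ~~ (k < K)%N) (t < a k))%N.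
Proof.
rewrite /prefix_count (bigID (fun k => k < K)%N) /=; congr (_ + _)%N.
  by apply: eq_bigl => k; rewrite ltn_ord.
by apply: eq_bigl => k; rewrite ltn_ord.
Qed.

Lemma prefix_count_excess a b t : excess a =1 excess b ->
  prefix_count a n t = prefix_count b n t.
Proof.
have E c : excess c t = (excess c t.+1 + prefix_count c n t)%N.
  rewrite /excess /prefix_count [X in (_ + X)%N](eq_bigl predT) -?big_split /=.
    by apply: eq_bigr => k _; lia.
  by move=> k; rewrite ltn_ord.
by move=> e; have := E a; have := E b; rewrite !e; lia.
Qed.

Lemma prefix_count_inj a b :
  (forall K t, prefix_count a K t = prefix_count b K t) -> a = b.
Proof.
move=> e; apply/mnmP=> k; have h t : (t < a k)%N = (t < b k)%N.
  have := e k.+1 t; rewrite !prefix_countS e => /addnI.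
  by case: (_ < a k)%N; case: (_ < b k)%N.
by have := h (a k); have := h (b k); rewrite !ltnn; lia.
Qed.

(** Either the first [K] entries of [a] all exceed [t], or no later entry does and the prefix
    already reaches the common total. The weakly increasing case below is dual. *)
Lemma prefix_count_dominant a b K t : dominant a -> excess a =1 excess b ->
  (prefix_count b K t <= prefix_count a K t)%N.
Proof.
move=> da e; have := prefix_count_excess t e.
rewrite (prefix_count_split a K) (prefix_count_split b K).
have [l /andP[Kl tl]|no] := pickP (fun l => ~~ (l < K)%N && (t < a l)%N).
  move=> _; apply: leq_sum => k kK; have := @dominant_le _ a k l da.
  by case: (t < b k)%N => //; lia.
rewrite [X in (_ + X)%N = _]big1 => [|k Kk]; first by lia.
by have := no k; rewrite Kk /= => ->.
Qed.

Lemma prefix_count_antidominant a b K t :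
  (forall k l, (k <= l)%N -> (a k <= a l)%N) -> excess a =1 excess b ->
  (prefix_count a K t <= prefix_count b K t)%N.
Proof.
move=> da e; have := prefix_count_excess t e.
rewrite (prefix_count_split a K) (prefix_count_split b K).
have [l /andP[lK tl]|no] := pickP (fun l => (l < K)%N && (t < a l)%N).
  have : (\sum_(k < n | ~~ (k < K)) (t < b k) <= \sum_(k < n | ~~ (k < K)) (t < a k))%N.
    apply: leq_sum => k kK; have := da l k.
    by case: (t < b k)%N => //; lia.
  by lia.
rewrite /prefix_count [X in (X <= _)%N]big1 // => k kK.
by have := no k; rewrite kK /= => ->.
Qed.

Lemma dominant_excess_inj a b : dominant a -> dominant b -> excess a =1 excess b -> a = b.
Proof.
move=> da db e; apply: prefix_count_inj => K t; apply/eqP; rewrite eqn_leq.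
by rewrite !prefix_count_dominant.
Qed.

Lemma mcoeffXM k p m : ('X_k * p)@_m = if (0 < m k)%N then p@_(m - U_(k))%MM else 0.
Proof.
case: ifP => mk.
  have e : (m = U_(k) + (m - U_(k)))%MM.
    by apply/mnmP=> l; rewrite mnmDE mnmBE mnm1E; case: eqP => [<-|]; lia.
  by rewrite {1}e mulrC mcoeffMX.
apply/eqP; rewrite mcoeff_eq0 mulrC (perm_mem (msuppMX _ _)).
by apply/mapP=> -[m' _ e]; move: mk; rewrite e mnmDE mnm1E eqxx.
Qed.

(** The coefficient of [x^m x_i] in the defining equation of [pi_i q] relates the coefficients of
    [pi_i q] and [q] at [m], with a correction at [m'], obtained by moving one unit from [hi i] to
    [lo i]. Since [m] is dominant, this raises the excess at threshold [m (lo i)], and [m'] lies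
    outside both supports. *)
Lemma is_key_dominant_coeff a p m : is_key a p -> dominant m ->
  excess m =1 excess a -> p@_m = 1.
Proof.
move=> kp dm; elim: kp => [b da e|b i q ai kq IH e].
  by rewrite (dominant_excess_inj dm da e) mcoeffX eqxx.
have {}IH : q@_m = 1 by apply: IH => t; rewrite e excess_swap.
have nlh := negPf (lo_neq_hi i); have nhl : (hi i == lo i) = false by rewrite eq_sym.
have := congr1 (mcoeff (m + U_(lo i))%MM) (demazureP i q).
rewrite mulrBl !mcoeffB !mcoeffXM !mnmDE !mnm1E eqxx nlh addn1 addn0 /= addmK IH.
case: ltnP => [mi|]; last by rewrite !subr0.
set m' := (_ - _)%MM.
have big : (excess m (m (lo i)) < excess m' (m (lo i)))%N.
  rewrite /excess !(sum_lo_hi i) /m' !mnmBE !mnmDE !mnm1E !eqxx nlh nhl /=.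
  rewrite [X in (_ < _ + X)%N](eq_bigr (fun k => m k - m (lo i))%N).
    by have := dm i; lia.
  move=> k /andP[n1 n2]; rewrite !mnmBE !mnmDE !mnm1E ![_ == k]eq_sym (negPf n1) (negPf n2).
  by rewrite addn0 subn0.
have -> : (demazure i q)@_m' = 0.
  apply/eqP; rewrite mcoeff_eq0; apply/negP=> /(is_key_excess (m (lo i)) (IsKeyStep ai kq)).
  by rewrite -e; lia.
have -> : (msym (simple i) q)@_m' = 0.
  apply/eqP; rewrite mcoeff_sym mcoeff_eq0 -/(swap i m').
  apply/negP=> /(is_key_excess (m (lo i)) kq).
  by rewrite !excess_swap -e; lia.
by rewrite !subr0.
Qed.

Lemma prefix_count_swap i a K t : K != i.+1 ->
  prefix_count (swap i a) K t = prefix_count a K t.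
Proof.
move=> neK; rewrite /prefix_count [RHS](reindex_inj (@perm_inj _ (simple i))) /=.
apply: eq_big => [k|k _]; last by rewrite swapE.
by rewrite /simple; case: tpermP => [->|->|] //=; lia.
Qed.

(* The extremal exponents of a key polynomial lie above [a] in Bruhat order,
   here in its tableau (prefix count) form. *)
Lemma is_key_bruhat a p m K t : is_key a p -> m \in msupp p ->
  excess m =1 excess a -> (prefix_count a K t <= prefix_count m K t)%N.
Proof.
move=> kp; elim: kp m K => [b db|b i q bi kq IH] m K.
  by rewrite msuppX inE => /eqP->.
case/msupp_demazure => m0 pm0 st e.
(* The excess of [m0] is squeezed between those of [m] and [b], which agree; so [m] is an end of the
   string of [m0]. *)
have e0 t' : excess m0 t' = excess b t'.
  apply/eqP; rewrite eqn_leq -{1}(excess_swap i b) (is_key_excess t' kq pm0) -e.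
  exact: excess_string st.
have {}IH K' : (prefix_count (swap i b) K' t <= prefix_count m0 K' t)%N.
  by apply: IH => // t'; rewrite excess_swap.
have IH' K' : K' != i.+1 -> (prefix_count b K' t <= prefix_count m K' t)%N.
  move=> neK; have := IH K'; rewrite prefix_count_swap //.
  have [|->|->] := excess_string_eq st; [|by []|by rewrite prefix_count_swap].
  by move=> t'; rewrite e e0.
(* Only the prefix of length [i.+1] separates the swapped positions. There the lengths [i] and
   [i.+2] suffice: the ascent makes the count of [b] convex, and the increments of that of [m] are
   at most one. *)
have [eK|] := eqVneq K i.+1; last exact: IH'.
have h1 := IH' i; have h2 := IH' i.+2.
have S1 c : prefix_count c i.+1 t = (prefix_count c i t + (t < c (lo i)))%N.
  exact: (prefix_countS c (lo i)).
have S2 c : prefix_count c i.+2 t = (prefix_count c i.+1 t + (t < c (hi i)))%N.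
  exact: (prefix_countS c (hi i)).
rewrite eK; move: h1 h2; rewrite !S2 !S1.
by move: bi; clear; lia.
Qed.

End Supports.

(** * Branching of bialternants *)

Section Bialternants.
Variable R : comNzRingType.
Implicit Types (x : nat -> R) (l : nat -> nat) (k N : nat).

Lemma det_sum_rows k N (P : 'I_k -> pred 'I_N) (F : 'I_k -> 'I_N -> 'I_k -> R) :
  \det (\matrix_(i, j) \sum_(r | P i r) F i r j) =
  \sum_(f in family P) \det (\matrix_(i, j) F i (f i) j).
Proof.
rewrite /determinant exchange_big /=; apply: eq_bigr => s _.
under eq_bigr => i _ do rewrite mxE.
rewrite bigA_distr_big_dep big_distrr /=; apply: eq_bigr => f _.
by congr (_ * _); apply: eq_bigr => i _; rewrite mxE.
Qed.

Lemma det_scale_rows k (c : 'I_k -> R) (A : 'M[R]_k) :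
  \det (\matrix_(i, j) (c i * A i j)) = (\prod_i c i) * \det A.
Proof.
have -> : \matrix_(i, j) (c i * A i j) = diag_mx (\row_i c i) *m A.
  by rewrite mul_diag_mx; apply/matrixP=> i j; rewrite !mxE.
by rewrite det_mulmx det_diag; congr (_ * _); apply: eq_bigr => i _; rewrite mxE.
Qed.

Lemma det_scale_cols k (c : 'I_k -> R) (A : 'M[R]_k) :
  \det (\matrix_(i, j) (c j * A i j)) = (\prod_i c i) * \det A.
Proof.
rewrite -det_tr -[\det A]det_tr -det_scale_rows; congr (\det _).
by apply/matrixP=> i j; rewrite !mxE.
Qed.

Lemma geometric_sum (u v : R) a b N : (a <= b)%N -> (b < N)%N ->
  (u - v) * (\sum_(r < N | (a <= r <= b)%N) u ^+ r * v ^+ (b - r))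
  = u ^+ b.+1 - u ^+ a * v ^+ (b.+1 - a).
Proof.
move=> ab bN; have -> : \sum_(r < N | (a <= r <= b)%N) u ^+ r * v ^+ (b - r)
    = \sum_(a <= r < b.+1) u ^+ r * v ^+ (b - r).
  rewrite big_geq_mkord.
  rewrite (@big_ord_widen_cond _ _ _ _ N (fun r => true && (a <= r)%N) (fun r => u ^+ r * v ^+ (b - r)) bN).
  by apply: eq_bigl => r; rewrite ltnS.
elim: b ab bN => [|b IH] ab bN.
  have -> : a = 0%N by lia.
  by rewrite big_nat1 /= !expr0 expr1; ring.
move: ab; rewrite leq_eqVlt => /orP[/eqP ->|ab].
  by rewrite big_nat1 subnn expr0 subSnn expr1 [in RHS]exprS; ring.
rewrite big_nat_recr /=; last by lia.
rewrite subnn expr0 mulr1 big_nat; under eq_bigr => r rb.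
  rewrite subSn ?exprS ?[_ * (v * _)]mulrCA; last by lia.
  over.
rewrite -big_nat -mulr_sumr mulrDr mulrCA IH; try by lia.
by rewrite (_ : (b.+2 - a)%N = (b.+1 - a).+1) ?exprS; [ring | lia].
Qed.

(** The determinant [a_(l + rho)] in the first [k] variables. Variables and parts are indexed by
    [nat] so that [k] can change in the induction. *)
Definition bialternant x k l : R := \det (\matrix_(i < k, j < k) x j ^+ (l i + (k.-1 - i))).

Definition extend k N (f : {ffun 'I_k -> 'I_N}) (i : nat) : nat := oapp (fun j => f j : nat) 0%N (insub i).

Lemma extendE k N (f : {ffun 'I_k -> 'I_N}) (i : 'I_k) : extend f i = f i.
Proof. by rewrite /extend valK. Qed.

Lemma extend_default k N (f : {ffun 'I_k -> 'I_N}) i : (k <= i)%N -> extend f i = 0%N.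
Proof. by move=> ki; rewrite /extend insubF //; lia. Qed.

(** The Gelfand-Tsetlin condition: when [l] has at most [k.+1] rows, [l] minus [f] is a horizontal
    strip. *)
Definition interlaced k N l : pred {ffun 'I_k -> 'I_N} :=
  family (fun (i : 'I_k) (r : 'I_N) => (l i.+1 <= r <= l i)%N).

(* Subtracting from each row the multiple of the next one that kills the last
   column turns the entries into geometric sums. *)
Lemma bialternant_branching x k N l : (forall i, (i < k)%N -> (l i.+1 <= l i < N)%N) ->
  bialternant x k.+1 l = (\prod_(j < k) (x j - x k)) *
    \sum_(f : {ffun 'I_k -> 'I_N} | interlaced l f)
      (\prod_(i < k.+1) x k ^+ (l i - extend f i)) * bialternant x k (extend f).
Proof.
(* [d i] is the gap between the exponents of rows [i] and [i.+1], shifts by the staircase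
   included. *)
move=> hl; pose d i := (l i - l i.+1).+1.
pose U : 'M[R]_k.+1 :=
  \matrix_(i, j) ((i == j)%:R - (j == i.+1 :> nat)%:R * x k ^+ d i).
have detU : \det U = 1.
  rewrite -det_tr det_trig.
    by rewrite big1 // => i _; rewrite !mxE eqxx (ltn_eqF (ltnSn i)) mul0r subr0.
  apply/is_trig_mxP => i j ij; rewrite !mxE -val_eqE /=.
  by rewrite (gtn_eqF ij) (ltn_eqF (ltnW ij : (i < j.+1)%N)) mul0r subr0.
rewrite /bialternant /=; set A := (X in \det X).
have -> : \det A = \det (U *m A) by rewrite det_mulmx detU mul1r.
set B := U *m A.
have BE (i : 'I_k) j : B (lift ord_max i) j =
    x j ^+ (l i + (k - i)) - x k ^+ d i * x j ^+ (l i.+1 + (k - i.+1)).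
  rewrite mxE (bigD1 (lift ord_max i)) //= (bigD1 (lift ord0 i)) /=; last first.
    by rewrite -val_eqE /= /bump; have := ltn_ord i; lia.
  rewrite big1 => [|c /andP[n1 n2]].
    rewrite !mxE -!val_eqE /= /bump /= !add1n (leqNgt k) ltn_ord /= add0n !eqxx.
    rewrite (ltn_eqF (ltnSn i)).
    by rewrite mul0r mul1r sub0r subr0 mul1r addr0 mulNr.
  rewrite mxE eq_sym (negPf n1); move: n2.
  rewrite -val_eqE /= /bump /= add1n (leqNgt k) ltn_ord add0n => /negPf ->.
  by rewrite !mul0r subr0 mul0r.
have BK : B ord_max ord_max = x k ^+ l k.
  rewrite mxE (bigD1 ord_max) //= big1 => [|c n1].
    by rewrite !mxE eqxx /= (ltn_eqF (ltnSn k)) mul0r subr0 mul1r subnn addn0 addr0.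
  by rewrite mxE eq_sym (negPf n1) (ltn_eqF (ltn_ord c)) mul0r subr0 mul0r.
have BL (i : 'I_k) : B (lift ord_max i) ord_max = 0.
  rewrite BE /= -exprD (_ : (d i + _)%N = (l i + (k - i))%N) ?subrr // /d.
  by have ik := ltn_ord i; have := hl i ik; lia.
rewrite (expand_det_col B ord_max) (bigD1 ord_max) //= big1 ?addr0 => [|c n1]; last first.
  by case: (unliftP ord_max c) n1 => [i ->|->]; rewrite ?eqxx // BL mul0r.
rewrite BK /cofactor addnn -mul2n exprM sqrrN !expr1n mul1r.
have BI (i j : 'I_k) : B (lift ord_max i) (lift ord_max j) = (x j - x k) *
    \sum_(r : 'I_N | (l i.+1 <= r <= l i)%N) x k ^+ (l i - r) * x j ^+ (r + (k.-1 - i)).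
  rewrite BE /= /bump (leqNgt k) ltn_ord add0n; have /andP[h1 h2] := hl i (ltn_ord i).
  transitivity (x j ^+ (k.-1 - i) * (x j ^+ (l i).+1 - x j ^+ l i.+1 * x k ^+ ((l i).+1 - l i.+1))).
    rewrite mulrBr mulrA -!exprD [x k ^+ _ * _]mulrC /d subSn //.
    by congr (x j ^+ _ - x j ^+ _ * _); have := ltn_ord i; lia.
  rewrite -(geometric_sum (x j) (x k) h1 h2) mulrCA; congr (_ * _).
  by rewrite mulr_sumr; apply: eq_bigr => r _; rewrite exprD; ring.
have -> : row' ord_max (col' ord_max B) = \matrix_(i, j) ((x j - x k) *
    (\matrix_(i, j) \sum_(r : 'I_N | (l i.+1 <= r <= l i)%N)
       x k ^+ (l i - r) * x j ^+ (r + (k.-1 - i))) i j).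
  by apply/matrixP=> i j; rewrite [LHS]mxE [LHS]mxE BI !mxE.
rewrite det_scale_cols det_sum_rows mulrCA; congr (_ * _).
rewrite mulr_sumr; apply: eq_bigr => f _.
(* Row [k] of [extend f] is zero, so its factor is the corner entry [x k ^+ l k] of the
   expansion. *)
rewrite big_ord_recr /= extend_default // subn0 [_ * x k ^+ _]mulrC -mulrA; congr (_ * _).
under [in RHS]eq_bigr => i _ do rewrite extendE.
rewrite -det_scale_rows; congr (\det _); apply/matrixP=> i j.
by rewrite !mxE extendE.
Qed.

End Bialternants.

(** * Branching of tableaux *)

Section Tableaux.
Variables (n N : nat).
Implicit Types (k : nat) (l : nat -> nat).

(* A tableau is a filling of the whole [n] by [N] rectangle, in which the
   sentinel value [n] marks the cells outside of the shape. *)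
Definition filling := {ffun 'I_n * 'I_N -> 'I_n.+1}.
Implicit Types T : filling.

(** The sentinel exceeds all entries, so rows remain weakly increasing across the boundary; columns
    are strict only above a genuine entry. *)
Definition is_tableau k l T : bool :=
  [forall b : 'I_n * 'I_N, if (b.2 < l b.1)%N then (T b < k)%N else T b == ord_max] &&
  [forall b : 'I_n * 'I_N, forall c : 'I_n * 'I_N,
     ((b.1 == c.1) && (b.2 <= c.2)%N ==> (T b <= T c)%N)
  && ((b.1 < c.1)%N && (b.2 == c.2) && (T c < n)%N ==> (T b < T c)%N)].

Lemma is_tableauP k l T : reflect
  [/\ forall (i : 'I_n) (j : 'I_N), (j < l i)%N -> (T (i, j) < k)%N,
      forall (i : 'I_n) (j : 'I_N), (l i <= j)%N -> T (i, j) = ord_max,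
      forall (i : 'I_n) (j j' : 'I_N), (j <= j')%N -> (T (i, j) <= T (i, j'))%N &
      forall (i i' : 'I_n) (j : 'I_N), (i < i')%N -> (T (i', j) < n)%N -> (T (i, j) < T (i', j))%N]
  (is_tableau k l T).
Proof.
apply: (iffP andP) => [[/forallP h1 /forallP h2]|[h1 h2 h3 h4]].
  split=> [i j ij|i j ij|i j j' jj|i i' j ii tn].
  - by have := h1 (i, j); rewrite /= ij.
  - by have := h1 (i, j); rewrite /= ltnNge ij => /eqP.
  - by have /forallP/(_ (i, j')) := h2 (i, j); rewrite /= eqxx jj => /andP[].
  by have /forallP/(_ (i', j)) := h2 (i, j); rewrite /= eqxx ii tn => /andP[].
split; apply/forallP=> -[i j] /=.
  by case: ltnP => [/h1|/h2 ->].
apply/forallP=> -[i' j'] /=; apply/andP; split; apply/implyP.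
  by case/andP=> /eqP <-; apply: h3.
by case/andP=> /andP[ii /eqP <-]; apply: h4.
Qed.

(** Column strictness forces this; it shows that values below [k] occur in the first [k] rows
    only. *)
Lemma tableau_row_le k l T (i : 'I_n) (j : 'I_N) : is_tableau k l T -> (i <= T (i, j))%N.
Proof.
case/is_tableauP=> _ _ _ h4; case: i => i lt_in /=.
elim: i lt_in => [//|i IH] lt_in; have [le|lt] := leqP n (T (Ordinal lt_in, j)); first by lia.
exact: leq_ltn_trans (IH (ltnW lt_in)) (h4 (Ordinal (ltnW lt_in)) _ _ _ lt).
Qed.

Lemma card_ord_lt c : (c <= N)%N -> #|[pred j : 'I_N | (j < c)%N]| = c.
Proof.
move=> cN; rewrite -sum1_card -(big_ord_widen _ (fun=> 1%N) cN).
by rewrite sum1_card card_ord.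
Qed.

Lemma card_down_closed (P : pred 'I_N) (j : 'I_N) :
  (forall j j' : 'I_N, (j <= j')%N -> P j' -> P j) -> P j = (j < #|P|)%N.
Proof.
move=> dc; apply/idP/idP => [Pj|].
  rewrite -(card_ord_lt (ltn_ord j)); apply/subset_leq_card/subsetP=> j'.
  by rewrite inE ltnS => /dc; apply.
apply: contraTT => nPj; rewrite -leqNgt -(card_ord_lt (ltnW (ltn_ord j))).
apply/subset_leq_card/subsetP=> j'; rewrite !inE => Pj'; rewrite ltnNge.
by apply: contra nPj => /dc; apply.
Qed.

Section Peel.
Variables (k : nat) (l : nat -> nat) (lt_kn : (k < n)%N).
Hypotheses (l_anti : forall i, (l i.+1 <= l i)%N) (l0 : forall i, (k < i)%N -> l i = 0%N).
Hypothesis lN : forall i, (l i <= N)%N.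

(** The shape that remains when the largest value [k] is erased. *)
Definition row_counts T : {ffun 'I_k -> 'I_N.+1} :=
  [ffun i => inord #|[pred j : 'I_N | (T (widen_ord (ltnW lt_kn) i, j) < k)%N]|].

Let l_le i i' : (i <= i')%N -> (l i' <= l i)%N.
Proof.
move=> ii; rewrite -(subnK ii); elim: (i' - i)%N => [//|d IH].
exact: leq_trans (l_anti _) IH.
Qed.

Lemma card_row_le (P : pred 'I_N) : (#|P| < N.+1)%N.
Proof. by rewrite ltnS -[X in (_ <= X)%N]card_ord max_card. Qed.

Lemma row_countsP T (i : 'I_n) (j : 'I_N) : is_tableau k.+1 l T ->
  (T (i, j) < k)%N = (j < extend (row_counts T) i)%N.
Proof.
move=> tT; have [lt_ik|le_ki] := ltnP i k; last first.
  by rewrite extend_default // ltnNge (leq_trans le_ki) // (tableau_row_le _ _ tT).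
rewrite (extendE (row_counts T) (Ordinal lt_ik)) ffunE inordK ?card_row_le //.
have -> : widen_ord (ltnW lt_kn) (Ordinal lt_ik) = i by apply: val_inj.
rewrite -card_down_closed // => j1 j2 j12 /=; apply: leq_ltn_trans.
by case/is_tableauP: tT => _ _ h3 _; apply: h3.
Qed.

Lemma row_counts_eq T f :
  (forall (i : 'I_n) (j : 'I_N), (T (i, j) < k)%N = (j < extend f i)%N) -> row_counts T = f.
Proof.
move=> h; apply/ffunP=> i; apply: val_inj; rewrite ffunE /= inordK ?card_row_le //.
rewrite -[RHS](@card_ord_lt (f i)); last by rewrite -ltnS.
by apply: eq_card => j; rewrite !inE h /= extendE.
Qed.

(** An entry of row [i.+1] is at most [k], so the entry above it is less than [k] and survives the
    erasure. *)
Lemma row_counts_interlaced T : is_tableau k.+1 l T -> interlaced l (row_counts T).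
Proof.
move=> tT; case/is_tableauP: (tT) => h1 h2 h3 h4.
apply/familyP=> i; rewrite unfold_in -extendE; set r := extend _ _.
have rN : (r <= N)%N by rewrite /r extendE -ltnS.
pose i0 := widen_ord (ltnW lt_kn) i.
apply/andP; split; rewrite leqNgt; apply/negP=> lt_r.
  have rN' : (r < N)%N by apply: leq_trans lt_r (lN _).
  have i1n : (i.+1 < n)%N by have := ltn_ord i; lia.
  have t1 := h1 (Ordinal i1n) (Ordinal rN') lt_r.
  have := h4 i0 (Ordinal i1n) (Ordinal rN') (leqnn _) (leq_trans t1 lt_kn).
  move=> t2; have : (T (i0, Ordinal rN') < k)%N by apply: leq_trans t2 _.
  by rewrite row_countsP //= ltnn.
have jN : (l i < N)%N by apply: leq_trans lt_r _.
have := row_countsP i0 (Ordinal jN) tT; rewrite /= lt_r h2 //=.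
by rewrite ltnNge ltnW.
Qed.

Section Fixed.
Variable f : {ffun 'I_k -> 'I_N.+1}.
Hypothesis lf : interlaced l f.

Let f_le i : (extend f i <= l i)%N.
Proof.
have [lt_ik|le_ki] := ltnP i k; last by rewrite extend_default.
by have /familyP/(_ (Ordinal lt_ik))/andP[_] := lf; rewrite -extendE.
Qed.

Let f_ge i : (i < k)%N -> (l i.+1 <= extend f i)%N.
Proof.
by move=> lt_ik; have /familyP/(_ (Ordinal lt_ik))/andP[+ _] := lf; rewrite -extendE.
Qed.

Let f_anti i i' : (i < i')%N -> (extend f i' <= extend f i)%N.
Proof.
move=> ii; have [lt_ik|le_ki] := ltnP i' k; last by rewrite extend_default.
apply: leq_trans (f_le _) _; apply: leq_trans (f_ge _); last by lia.
exact: l_le.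
Qed.

(** With [unpeel], a bijection between the tableaux of shape [l] whose values below [k] occupy [f]
    and the tableaux of shape [f] with values below [k]. *)
Definition peel T : filling :=
  [ffun b : 'I_n * 'I_N => if (b.2 < extend f b.1)%N then T b else ord_max].

Definition unpeel T : filling := [ffun b : 'I_n * 'I_N =>
  if (b.2 < extend f b.1)%N then T b else if (b.2 < l b.1)%N then inord k else ord_max].

Let inordk : (inord k : 'I_n.+1) = k :> nat.
Proof. by rewrite inordK // ltnW. Qed.

Lemma peelK T : is_tableau k.+1 l T -> row_counts T = f -> unpeel (peel T) = T.
Proof.
move=> tT ef; case/is_tableauP: (tT) => h1 h2 _ _.
apply/ffunP=> -[i j]; rewrite !ffunE /= -ef -row_countsP //.
case: ltnP => // le_k; case: ltnP => [/h1|/h2 ->//].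
by rewrite ltnS => ge_k; apply: val_inj; rewrite /= inordk; apply/eqP; rewrite eqn_leq ge_k le_k.
Qed.

Lemma is_tableau_peel T :
  is_tableau k.+1 l T -> row_counts T = f -> is_tableau k (extend f) (peel T).
Proof.
move=> tT ef; case/is_tableauP: (tT) => h1 h2 h3 h4.
have rc (i : 'I_n) (j : 'I_N) : (T (i, j) < k)%N = (j < extend f i)%N by rewrite -ef row_countsP.
apply/is_tableauP; split=> [i j ij|i j ij|i j j' jj|i i' j ii].
- by rewrite ffunE /= ij rc.
- by rewrite ffunE /= ltnNge ij.
- rewrite !ffunE /=; case: (ltnP j' _) => [lt_j'|_]; last by rewrite -ltnS ltn_ord.
  by rewrite (leq_ltn_trans jj lt_j'); apply: h3.
rewrite !ffunE /=; case: (ltnP j (extend f i')) => [lt_j tn|]; last by rewrite /= ltnn.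
by rewrite (leq_trans lt_j (f_anti ii)); apply: h4.
Qed.

Lemma unpeel_lt T (i : 'I_n) (j : 'I_N) : is_tableau k (extend f) T ->
  (unpeel T (i, j) < k)%N = (j < extend f i)%N.
Proof.
case/is_tableauP=> h1 h2 _ _; rewrite ffunE /=.
case: (ltnP j (extend f i)) => [/h1 //|_]; case: ifP => _; first by rewrite inordk ltnn.
by rewrite /= ltnNge ltnW.
Qed.

Lemma is_tableau_unpeel T : is_tableau k (extend f) T -> is_tableau k.+1 l (unpeel T).
Proof.
case/is_tableauP=> h1 h2 h3 h4.
apply/is_tableauP; split=> [i j ij|i j ij|i j j' jj|i i' j ii].
- rewrite ffunE /= ij; case: (ltnP j (extend f i)) => [/h1 /ltnW //|_].
  by rewrite inordk.
- by rewrite ffunE /= !ltnNge ij (leq_trans (f_le _) ij).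
- rewrite !ffunE /=; case: (ltnP j' (extend f i)) => [lt_j'|_].
    by rewrite (leq_ltn_trans jj lt_j'); apply: h3.
  case: (ltnP j' (l i)) => [lt_j'|_]; last by rewrite -ltnS ltn_ord.
  rewrite (leq_ltn_trans jj lt_j') inordk; case: (ltnP j (extend f i)) => [/h1 /ltnW //|_].
  by rewrite inordk.
rewrite !ffunE /=; case: (ltnP j (extend f i')) => [lt_j tn|_].
  by rewrite (leq_trans lt_j (f_anti ii)); apply: h4.
case: (ltnP j (l i')) => [lt_j _|]; last by rewrite /= ltnn.
have le_ik : (i' <= k)%N by rewrite leqNgt; apply/negP=> /l0 e; rewrite e in lt_j.
have lt_ji : (j < extend f i)%N.
  apply: leq_trans lt_j _; apply: leq_trans (f_ge _); last by lia.
  exact: l_le.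
by rewrite lt_ji inordk; apply: h1.
Qed.

Lemma unpeelK T : is_tableau k (extend f) T -> peel (unpeel T) = T.
Proof.
case/is_tableauP=> _ h2 _ _; apply/ffunP=> -[i j]; rewrite !ffunE /=.
by case: ltnP => // /h2.
Qed.

End Fixed.
End Peel.

Variables (R : comNzRingType) (y : nat -> R).
(** The sentinel has weight one, so products may run over the whole rectangle. *)
Hypothesis yn : y n = 1.

Definition tableau_sum k l : R := \sum_(T | is_tableau k l T) \prod_b y (T b).

Lemma prod_interval (c : R) a b : (b <= N)%N ->
  \prod_(j < N) (if (a <= j < b)%N then c else 1) = c ^+ (b - a).
Proof.
move=> bN; rewrite -big_mkcond /= -prodr_const_nat big_geq_mkord.
rewrite (@big_ord_widen_cond _ _ _ _ N (fun j => true && (a <= j)%N) (fun=> c) bN).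
by apply: eq_bigl.
Qed.

Lemma tableau_sum_branching k l : (k < n)%N -> (forall i, (l i.+1 <= l i)%N) ->
  (forall i, (k < i)%N -> l i = 0%N) -> (forall i, (l i <= N)%N) ->
  tableau_sum k.+1 l = \sum_(f : {ffun 'I_k -> 'I_N.+1} | interlaced l f)
    (\prod_(i < k.+1) y k ^+ (l i - extend f i)) * tableau_sum k (extend f).
Proof.
move=> lt_kn l_anti l0 lN; rewrite /tableau_sum.
rewrite (partition_big (row_counts lt_kn) (interlaced (N := N.+1) l)) /=; last first.
  by move=> T; apply: row_counts_interlaced.
apply: eq_bigr => f lf; rewrite mulr_sumr.
rewrite (reindex_onto (unpeel l f) (peel f)) /=; last first.
  by move=> T /andP[tT /eqP ef]; apply: peelK ef.
have pE T : is_tableau k.+1 l (unpeel l f T) && (row_counts lt_kn (unpeel l f T) == f) &&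
    (peel f (unpeel l f T) == T) = is_tableau k (extend f) T.
  apply/idP/idP => [/andP[/andP[tT /eqP ef] /eqP <-]|tT].
    exact: (is_tableau_peel (lt_kn := lt_kn)) tT ef.
  rewrite (is_tableau_unpeel lt_kn) // unpeelK // eqxx andbT.
  by apply/eqP/row_counts_eq => i j; apply: unpeel_lt.
apply: eq_big => [T|T]; first exact: pE.
rewrite pE => /is_tableauP[_ h2 _ _].
transitivity (\prod_(b : 'I_n * 'I_N)
  ((if (extend f b.1 <= b.2 < l b.1)%N then y k else 1) * y (T b))).
  apply: eq_bigr => -[i j] _; rewrite ffunE /=; case: ltnP => [_|/h2 ->].
    by rewrite mul1r.
  by rewrite /= yn mulr1; case: ifP => _ //=; rewrite inordK // ltnW.
rewrite big_split /=; congr (_ * _).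
rewrite -(pair_bigA _ (fun (i : 'I_n) (j : 'I_N) =>
  if (extend f i <= j < l i)%N then y k else 1)) /=.
rewrite (big_ord_widen _ (fun i => y k ^+ (l i - extend f i)) lt_kn) [RHS]big_mkcond /=.
apply: eq_bigr => i _; rewrite prod_interval //; case: ifP => // /negbT.
by rewrite -leqNgt => /l0 ->; rewrite sub0n.
Qed.

Lemma tableau_sum_empty k l : (forall i, l i = 0%N) -> tableau_sum k l = 1.
Proof.
move=> l0; rewrite /tableau_sum (big_pred1 [ffun=> ord_max]) => [|T].
  by apply: big1 => b _; rewrite ffunE.
apply/is_tableauP/eqP => [[_ h2 _ _]|->].
  by apply/ffunP=> -[i j]; rewrite ffunE h2 // l0.
split=> [i j|i j|i j j'|i i' j]; rewrite ?l0 ?ffunE //.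
Qed.

(** The two branching rules differ by the factors [y j - y k] alone, which build up the Vandermonde
    product. *)
Lemma bialternant_tableau_sum k l : (k <= n)%N -> (forall i, (l i.+1 <= l i)%N) ->
  (forall i, (k <= i)%N -> l i = 0%N) -> (forall i, (l i <= N)%N) ->
  bialternant y k l = (\prod_(c < k) \prod_(j < c) (y j - y c)) * tableau_sum k l.
Proof.
elim: k l => [|k IH] l le_kn l_anti l0 lN.
  rewrite /bialternant det_mx00 big_ord0 mul1r tableau_sum_empty // => i.
  exact: l0.
rewrite (@bialternant_branching _ y k N.+1) => [|i lt_ik]; last by rewrite l_anti ltnS lN.
rewrite tableau_sum_branching // big_ord_recr /= -mulrA [RHS]mulrCA; congr (_ * _).
rewrite mulr_sumr; apply: eq_bigr => f lf; rewrite mulrCA; congr (_ * _).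
have f_le i : (extend f i <= l i)%N.
  have [lt_ik|le_ki] := ltnP i k; last by rewrite extend_default.
  by have /familyP/(_ (Ordinal lt_ik))/andP[_] := lf; rewrite -extendE.
apply: IH => [|i|i|i]; first exact: ltnW.
- have [lt_ik|le_ki] := ltnP i k; last by rewrite !extend_default //; lia.
  apply: leq_trans (f_le _) _.
  by have /familyP/(_ (Ordinal lt_ik))/andP[+ _] := lf; rewrite -extendE.
- exact: extend_default.
- exact: leq_trans (f_le _) (lN _).
Qed.

End Tableaux.

(** * Alternating sums and Schur polynomials *)

Section Alternants.
Variable n : nat.
Implicit Types (i j : 'I_n.-1) (k : 'I_n) (p q : {mpoly int[n]}) (a m : 'X_{1..n}).

Definition alternant p : {mpoly int[n]} := \sum_(w : 'S_n) (-1) ^+ w * msym w p.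

Lemma alternantD p q : alternant (p + q) = alternant p + alternant q.
Proof.
by rewrite -big_split /=; apply: eq_bigr => w _; rewrite msymD mulrDr.
Qed.

Lemma alternantN p : alternant (- p) = - alternant p.
Proof. by rewrite -sumrN; apply: eq_bigr => w _; rewrite msymN mulrN. Qed.

Lemma alternant_msym_simple i p : alternant (msym (simple i) p) = - alternant p.
Proof.
rewrite [in RHS]/alternant (reindex_inj (mulgI (simple i))) /= -sumrN.
apply: eq_bigr => w _; rewrite odd_permM odd_tperm lo_neq_hi msymMm.
by rewrite signr_addb expr1 !mulN1r mulNr opprK.
Qed.

Lemma alternantM_sym p q : (forall w, msym w q = q) -> alternant (p * q) = alternant p * q.
Proof.
move=> sq; rewrite /alternant mulr_suml; apply: eq_bigr => w _.
by rewrite msymM sq mulrA.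
Qed.

Definition staircase : 'X_{1..n} := [multinom (n.-1 - k)%N | k < n].

(* With [x^rho = x_i g] and [g] symmetric under [s_i], the symmetrization in
   [pi_i] is absorbed by the alternating sum. *)
Lemma alternant_demazure i p :
  alternant ('X_[staircase] * demazure i p) = alternant ('X_[staircase] * p).
Proof.
(* Consecutive staircase exponents differ by one, so removing one [x_i] equalizes them at [lo i] and
   [hi i]. *)
pose g : {mpoly int[n]} := 'X_[staircase - U_(lo i)].
have eg : 'X_[staircase] = 'X_(lo i) * g.
  rewrite /g -mpolyXD; congr 'X_[_]; apply/mnmP=> k.
  rewrite mnmDE mnmBE mnm1E mnmE; case: eqP => [<-|_] /=; last by rewrite subn0.
  by have := ltn_ord (hi i); rewrite /=; lia.
have sg : msym (simple i) g = g.
  rewrite msymX; congr 'X_[_]; apply/mnmP=> k; rewrite mnmE tpermV !mnmBE !mnm1E !mnmE.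
  rewrite /simple; case: tpermP => [->|->|//]; rewrite eqxx (negPf (lo_neq_hi i)) /=; lia.
have X2 (f : {mpoly int[n]}) h : f - h = f + h -> h = 0.
  move=> e; apply/mpolyP=> m; have := congr1 (mcoeff m) e.
  by rewrite mcoeffB mcoeffD mcoeff0; lia.
have sD := msym_demazure i p; have eD := demazureP i p.
move: (demazure i p) sD eD => D sD eD.
have e1 : alternant ('X_(hi i) * g * D) = - alternant ('X_(lo i) * g * D).
  by rewrite -(alternant_msym_simple i) !msymM msymU simple_lo sg sD.
have e2 : alternant ('X_(hi i) * g * msym (simple i) p) = - alternant ('X_(lo i) * g * p).
  by rewrite -(alternant_msym_simple i) !msymM msymU simple_lo sg.
have e3 : 'X_(lo i) * g * D - 'X_(hi i) * g * D
    = 'X_(lo i) * g * p - 'X_(hi i) * g * msym (simple i) p.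
  by rewrite -!mulrBl mulrAC eD mulrBl !(mulrAC _ _ g).
(* Each side now occurs twice; the factor 2 is cancelled coefficientwise in the integers. *)
have := congr1 alternant e3; rewrite !alternantD !alternantN e1 e2 !opprK eg.
move: (alternant _) (alternant _) => u v e.
apply/mpolyP=> m; have := congr1 (mcoeff m) e.
by rewrite !mcoeffD; lia.
Qed.

Lemma alternant_is_key a p m : is_key a p -> dominant m -> excess m =1 excess a ->
  alternant ('X_[staircase] * p) = alternant 'X_[staircase + m].
Proof.
move=> kp dm; elim: kp => [b db e|b i q bi kq IH e].
  by rewrite (dominant_excess_inj dm db e) mpolyXD.
by rewrite alternant_demazure IH // => t; rewrite e excess_swap.
Qed.

(** The default 1 is the weight of the sentinel [n]. *)
Definition variable (v : nat) : {mpoly int[n]} := oapp (fun k : 'I_n => 'X_k) 1 (insub v).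

Lemma variableE k : variable k = 'X_k.
Proof. by rewrite /variable valK. Qed.

Lemma variable_default : variable n = 1.
Proof. by rewrite /variable insubF //= ltnn. Qed.

Lemma alternant_bialternant m (l : nat -> nat) : (forall k, m k = l k) ->
  alternant 'X_[staircase + m] = bialternant variable n l.
Proof.
move=> ml; apply: eq_bigr => w _; congr (_ * _).
rewrite msymX (mpolyXE _ w); apply: eq_bigr => k _.
by rewrite !mxE variableE mnmE permK mnmDE mnmE ml addnC.
Qed.

Lemma is_key_sym_all a p : is_key a p -> (forall i, (a (lo i) <= a (hi i))%N) ->
  forall w, msym w p = p.
Proof.
move=> kp asc w; have [s /andP[/eqP <- _]] := reduced_word_exists w.
elim: s => [|i s IH] /=; first exact: msym1m.
by rewrite msymMm IH (is_key_sym (asc i) kp).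
Qed.

End Alternants.

(** * Schur polynomials as sums over rectangular fillings *)

Section SchurAsRectangularFillings.
Variables (n : nat) (la : n.-tuple nat).

Definition part (i : nat) : nat := nth 0%N la i.

Lemma part_tnth (i : 'I_n) : part i = tnth la i.
Proof. by rewrite (tnth_nth 0%N). Qed.

Definition width : nat := \max_(i < n) part i.

Lemma part_le_width (i : nat) : (part i <= width)%N.
Proof.
have [lt_in|le_ni] := ltnP i n; last by rewrite /part nth_default // size_tuple.
exact: (@leq_bigmax _ (fun i : 'I_n => part i) (Ordinal lt_in)).
Qed.

Lemma box_lt_width (b : box la) : (tagged b < width)%N.
Proof.
by apply: leq_trans (ltn_ord _) _; rewrite -part_tnth part_le_width.
Qed.

Definition cell (b : box la) : 'I_n * 'I_width := (tag b, Ordinal (box_lt_width b)).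

Lemma cellP (c : 'I_n * 'I_width) : (c.2 < part c.1)%N -> exists b, cell b = c.
Proof.
case: c => i j /=; rewrite part_tnth => lt_j.
by exists (Tagged (fun i => 'I_(tnth la i)) (Ordinal lt_j)); congr pair; apply: val_inj.
Qed.

Lemma cell_inj : injective cell.
Proof.
case=> [i j] [i' j'] [e]; case: i' / e j' => j' /= e.
by congr existT; apply: val_inj.
Qed.

Lemma cell_inside (b : box la) : ((cell b).2 < part (cell b).1)%N.
Proof. by rewrite part_tnth /= ltn_ord. Qed.

Definition to_filling (T : {ffun box la -> 'I_n}) : filling n width :=
  [ffun c => if [pick b | cell b == c] is Some b then widen_ord (leqnSn n) (T b)
             else ord_max].

(** The default [tag b] supplies an inhabitant of ['I_n] for cells that hold the sentinel. *)
Definition of_filling (F : filling n width) : {ffun box la -> 'I_n} :=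
  [ffun b => insubd (tag b) (val (F (cell b)))].

Lemma to_filling_cell T b : to_filling T (cell b) = T b :> nat.
Proof.
rewrite ffunE; case: pickP => [b' /eqP/cell_inj -> //|/(_ b)].
by rewrite eqxx.
Qed.

Lemma to_filling_out T (c : 'I_n * 'I_width) : (part c.1 <= c.2)%N -> to_filling T c = ord_max.
Proof.
move=> out; rewrite ffunE; case: pickP => // b /eqP e.
by move: out; rewrite -e leqNgt cell_inside.
Qed.

Lemma to_fillingK : cancel to_filling of_filling.
Proof.
move=> T; apply/ffunP=> b; apply: val_inj; rewrite ffunE val_insubd /=.
by rewrite to_filling_cell ltn_ord.
Qed.

Lemma of_fillingK F : is_tableau n part F -> to_filling (of_filling F) = F.
Proof.
case/is_tableauP=> h1 h2 _ _; apply/ffunP=> c.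
have [/cellP[b <-]|out] := ltnP c.2 (part c.1).
  apply: val_inj; rewrite /= to_filling_cell ffunE val_insubd.
  by rewrite [cell b]surjective_pairing h1 // cell_inside.
by rewrite to_filling_out //; case: c out => i j /= /h2.
Qed.

Hypothesis la_part : is_partition la.

Lemma part_anti (i i' : nat) : (i <= i')%N -> (part i' <= part i)%N.
Proof.
move=> ii; have [lt_in|le_ni] := ltnP i' n; last by rewrite /part nth_default // size_tuple.
have geq_trans : transitive geq by move=> x y z /= h1 h2; apply: leq_trans h2 h1.
have geq_refl : reflexive geq by move=> x; exact: leqnn.
by apply: (sorted_leq_nth geq_trans geq_refl 0%N la_part); rewrite ?inE ?size_tuple //; lia.
Qed.

Lemma is_tableau_to_filling T : is_tableau n part (to_filling T) = is_ssyt T.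
Proof.
apply/is_tableauP/forallP => [[_ _ h3 h4] b|h].
  apply/forallP=> c; apply/andP; split; apply/implyP.
    case/andP=> /eqP e bc; rewrite -!to_filling_cell; move: bc; rewrite /cell.
    by case: c e => i j /= e; case: i / e j => j bc; apply: h3.
  case/andP=> lt_bc /eqP e; rewrite -!to_filling_cell /cell.
  have -> : Ordinal (box_lt_width b) = Ordinal (box_lt_width c) by apply: val_inj.
  by apply: h4 => //; rewrite -/(cell c) to_filling_cell ltn_ord.
have colE b (i : 'I_n) (j : 'I_width) : cell b = (i, j) -> tagged b = j :> nat.
  by move/(congr1 (fun c : 'I_n * 'I_width => val c.2)).
have rowE b (i : 'I_n) (j : 'I_width) : cell b = (i, j) -> tag b = i :> nat.
  by move/(congr1 (fun c : 'I_n * 'I_width => val c.1)).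
have H b c := andP (forallP (h b) c).
split=> [i j ij|i j ij|i j j' jj|i i' j ii].
- by have [b <-] := @cellP (i, j) ij; rewrite to_filling_cell ltn_ord.
- exact: to_filling_out.
- have [ij'|out] := ltnP j' (part i); last first.
    by rewrite (@to_filling_out _ (i, j')) // -ltnS ltn_ord.
  have [b eb] := @cellP (i, j) (leq_ltn_trans jj ij').
  have [c ec] := @cellP (i, j') ij'.
  rewrite -eb -ec !to_filling_cell; have [/implyP + _] := H b c; apply.
  apply/andP; split; first exact/eqP/(etrans (congr1 fst eb) (esym (congr1 fst ec))).
  by rewrite (colE _ _ _ eb) (colE _ _ _ ec).
have [ij'|out] := ltnP j (part i'); last first.
  by rewrite (@to_filling_out _ (i', j)) //= ltnn.
(* As [la] is a partition, the cell above a cell of the diagram belongs to the diagram. *)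
have [b eb] := @cellP (i, j) (leq_trans ij' (part_anti (ltnW ii))).
have [c ec] := @cellP (i', j) ij'.
rewrite -eb -ec !to_filling_cell => _; have [_ /implyP] := H b c; apply.
by rewrite (colE _ _ _ eb) (colE _ _ _ ec) (rowE _ _ _ eb) (rowE _ _ _ ec) ii eqxx.
Qed.

Lemma schur_tableau_sum : schur la = tableau_sum n width (@variable n) n part.
Proof.
rewrite /schur /tableau_sum (reindex_onto to_filling of_filling) /=; last first.
  by move=> F; apply: of_fillingK.
apply: eq_big => [T|T _]; first by rewrite is_tableau_to_filling to_fillingK eqxx andbT.
rewrite (bigID (fun c : 'I_n * 'I_width => c.2 < part c.1)%N) /=.
rewrite [X in _ * X]big1 ?mulr1 => [|c]; last first.
  by rewrite -leqNgt => /to_filling_out ->; exact: variable_default.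
rewrite (reindex_omap cell (fun c => [pick b | cell b == c])) /=; last first.
  move=> c /cellP[b <-]; case: pickP => [b' /eqP e|/(_ b)]; first by rewrite /= e.
  by rewrite eqxx.
apply: eq_big => [b|b _]; last by rewrite -variableE to_filling_cell.
have /= -> := cell_inside b.
by case: pickP => [b' /eqP/cell_inj ->|/(_ b)]; rewrite eqxx.
Qed.

Lemma bialternant_schur : bialternant (@variable n) n part =
  (\prod_(c < n) \prod_(j < c) (@variable n j - @variable n c)) * schur la.
Proof.
rewrite schur_tableau_sum; apply: bialternant_tableau_sum => // [|i|i|i].
- exact: variable_default.
- exact: part_anti.
- by move=> le_ni; rewrite /part nth_default // size_tuple.
- exact: part_le_width.
Qed.

End SchurAsRectangularFillings.

(** * Keys, Young keys and Schur polynomials compared *)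

Section KeySchur.
Variable n : nat.
Implicit Types (la a : n.-tuple nat) (p : {mpoly int[n]}).

Definition rev_tuple la : n.-tuple nat := [tuple of rev la].

Lemma excess_sum la t : excess (Multinom la) t = \sum_(v <- la) (v - t)%N.
Proof. by rewrite big_tuple. Qed.

Lemma excess_perm_eq la a : perm_eq la a -> excess (Multinom la) =1 excess (Multinom a).
Proof. by move=> e t; rewrite !excess_sum; apply: perm_big. Qed.

Lemma excess_rev la : excess (Multinom (rev_tuple la)) =1 excess (Multinom la).
Proof. by apply: excess_perm_eq; rewrite perm_rev. Qed.

Lemma excess_sort la : excess (Multinom (sort_comp la)) =1 excess (Multinom la).
Proof. by apply: excess_perm_eq; rewrite perm_sort. Qed.

Lemma rev_tupleE la (k : 'I_n) : Multinom (rev_tuple la) k = Multinom la (rev_ord k).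
Proof. by rewrite !(mnm_nth 0%N) /= nth_rev size_tuple ?ltn_ord. Qed.

Lemma rev_partition_le la (k l : 'I_n) : is_partition la -> (k <= l)%N ->
  (Multinom (rev_tuple la) k <= Multinom (rev_tuple la) l)%N.
Proof.
move=> pla kl; rewrite !rev_tupleE; apply: (dominant_le (sorted_dominant pla)).
by rewrite /=; lia.
Qed.

Lemma key_rev_sym la (w : 'S_n) :
  is_partition la -> msym w (key (rev_tuple la)) = key (rev_tuple la).
Proof.
move=> pla; apply: is_key_sym_all (key_is_key _) _ w => i.
exact: rev_partition_le.
Qed.

Lemma vandermonde_neq0 :
  \prod_(c < n) \prod_(j < c) (@variable n j - @variable n c) != 0.
Proof.
apply/prodf_neq0 => c _; apply/prodf_neq0 => j _.
have jn : (j < n)%N by apply: ltn_trans (ltn_ord j) (ltn_ord c).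
rewrite (variableE (Ordinal jn)) variableE; apply: mpolyXB_neq0.
by rewrite -val_eqE /= ltn_eqF.
Qed.

Lemma key_rev_schur la : is_partition la -> key (rev_tuple la) = schur la.
Proof.
move=> pla; set p := key _.
have A : alternant 'X_[staircase n] * p = alternant 'X_[staircase n + Multinom la].
  rewrite -alternantM_sym; last by move=> w; apply: key_rev_sym.
  apply: alternant_is_key (key_is_key _) (sorted_dominant pla) _ => t.
  by rewrite excess_rev.
(* The Weyl denominator formula, obtained as the bialternant formula of the empty shape in a
   rectangle of width 0. *)
have B0 : alternant 'X_[staircase n] = \prod_(c < n) \prod_(j < c) (@variable n j - @variable n c).
  rewrite -[staircase n]addm0 (@alternant_bialternant _ _ (fun=> 0%N)) => [|k]; last exact: mnm0E.
  have vn := variable_default n.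
  by rewrite (@bialternant_tableau_sum n 0) // tableau_sum_empty // mulr1.
have Bla : alternant 'X_[staircase n + Multinom la] = bialternant (@variable n) n (part la).
  by apply: alternant_bialternant => k; rewrite part_tnth mnm_tnth.
apply: (mulfI vandermonde_neq0); rewrite -B0 A Bla B0.
exact: bialternant_schur.
Qed.

Lemma mcoeff_rev_vars p (m : 'X_{1..n}) :
  (rev_vars p)@_m = p@_[multinom m (rev_ord k) | k < n].
Proof. by rewrite mcoeff_sym; congr (_@__); apply/mnmP=> k; rewrite !mnmE permE. Qed.

Lemma rev_sort_in_young_key a :
  (young_key a)@_(Multinom (rev_tuple (sort_comp a))) = 1.
Proof.
rewrite mcoeff_rev_vars.
have -> : [multinom Multinom (rev_tuple (sort_comp a)) (rev_ord k) | k < n]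
    = Multinom (sort_comp a).
  by apply/mnmP=> k; rewrite mnmE rev_tupleE rev_ordK.
apply: is_key_dominant_coeff (key_is_key _) _ _.
  exact/sorted_dominant/sort_comp_sorted.
by move=> t; rewrite excess_sort -(excess_rev a).
Qed.

Lemma excess_young_key a (m : 'X_{1..n}) t :
  m \in msupp (young_key a) -> (excess m t <= excess (Multinom a) t)%N.
Proof.
rewrite mcoeff_msupp mcoeff_rev_vars -mcoeff_msupp => h.
have := is_key_excess t (key_is_key (rev_tuple a)) h; rewrite excess_rev.
have -> : [multinom m (rev_ord k) | k < n] = [multinom m (perm (@rev_ord_inj n) k) | k < n].
  by apply/mnmP=> k; rewrite !mnmE permE.
by rewrite excess_perm.
Qed.

(** An extremal exponent of each side lies in the support of the other, so the excess functions
    agree and [a] and [b] have the same entries. The weakly increasing rearrangement is then both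
    above and below [a] in prefix counts. *)
Lemma key_eq_young_key a b : key a = young_key b -> a = rev_tuple (sort_comp b).
Proof.
move=> e.
have le_ab t : (excess (Multinom a) t <= excess (Multinom b) t)%N.
  rewrite -excess_sort; apply: excess_young_key; rewrite -e mcoeff_msupp.
  rewrite (is_key_dominant_coeff (key_is_key a)) ?oner_neq0 //.
    exact/sorted_dominant/sort_comp_sorted.
  exact: excess_sort.
have in_a : Multinom (rev_tuple (sort_comp b)) \in msupp (key a).
  by rewrite e mcoeff_msupp rev_sort_in_young_key oner_neq0.
have eab : excess (Multinom (rev_tuple (sort_comp b))) =1 excess (Multinom a).
  move=> t; apply/eqP; rewrite eqn_leq (is_key_excess t (key_is_key a) in_a).
  by rewrite excess_rev excess_sort le_ab.
suff em : Multinom a = Multinom (rev_tuple (sort_comp b)).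
  by have := congr1 (@multinom_val n) em.
apply: prefix_count_inj => K t; apply/eqP; rewrite eqn_leq.
rewrite (is_key_bruhat K t (key_is_key a) in_a eab) andTb.
apply: prefix_count_antidominant eab => k l; apply: rev_partition_le.
exact: sort_comp_sorted.
Qed.

End KeySchur.

Theorem mainTheorem6 (n : nat) (p : {mpoly int[n]}) :
  ((exists a : n.-tuple nat, p = key a) /\
   (exists b : n.-tuple nat, p = young_key b)) <->
  (exists la : n.-tuple nat, is_partition la /\ p = schur la).
Proof.
split=> [[[a ->] [b e]]|[la [pla ->]]].
  have pb : is_partition (sort_comp b) by exact: sort_comp_sorted.
  exists (sort_comp b); split=> //.
  by rewrite (key_eq_young_key e) key_rev_schur.
split; first by exists (rev_tuple la); rewrite key_rev_schur.
(* The composition inside [young_key la] is the reversal of [la], whose key is unchanged when the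
   variables are reversed. *)
by exists la; rewrite /young_key /rev_vars key_rev_sym // key_rev_schur.
Qed.
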